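(* Let $a,b,c$ be positive numbers with $a<b<c$, $b-a<c_0<a$, $0<c_1<2a-b$, $\lfloor c/b\rfloor\ge2$, $a/b=p/q$ for coprime positive integers $p,q$, and $c/b\in\mathbb Z/q$, where $c_0=c-\lfloor c/b\rfloor b$ and $c_1=\lfloor c/b\rfloor b-\lfloor\lfloor c/b\rfloor b/a\rfloor a$. Then $\mathcal S_{a,b,c}\ne\emptyset$ if and only if one of the following holds: 1) $c_0<\gcd(a,c_1)$; 2) $b-c_0<\gcd(a,c_1+b)$; 3) there exist nonnegative integers $d_1,d_2,d_3,d_4$ such that, with $N=d_1+d_2+d_3+d_4+2$ and $B_d=a-(d_1+d_2+1)(b-a)$: $0<B_d\in N(b/q)\mathbb Z$; $Nc_1+(d_1+d_3+1)(b-a)\in a\mathbb Z$; $(d_1+d_2+1)(Nc_1+(d_1+d_3+1)(b-a))-(d_1+d_3+1)a\in Na\mathbb Z$; $c_0=(d_1+1)(b-a)+(d_1+d_3+1)B_d/N+\delta$ for some $\delta$ with $-\min(B_d/N,a-c_0)<\delta<\min(B_d/N,c_0+a-b)$; $\gcd(Nc_1+(d_1+d_3+1)(b-a),Na)=a$; and $\#E^d_{a,b,c}=d_1$, where $E^d_{a,b,c}=\{n\in\mathbb Z\cap[1,d_1+d_2+1]: n(Nc_1+(d_1+d_3+1)(b-a))\in(0,(d_1+d_3+1)a)+Na\mathbb Z\}$.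
   Context: For $a,b,c>0$ and $t\in\mathbb R$, $\mathbf M_{a,b,c}(t)=(\chi_{[0,c)}(t-\mu+\lambda))_{\mu\in a\mathbb Z,\lambda\in b\mathbb Z}$ is the infinite matrix with rows indexed by $a\mathbb Z$ and columns by $b\mathbb Z$, acting by $(\mathbf M_{a,b,c}(t)\mathbf x)(\mu)=\sum_{\lambda\in b\mathbb Z}\chi_{[0,c)}(t-\mu+\lambda)\mathbf x(\lambda)$. $\mathcal B_b^0$ is the set of vectors $(\mathbf x(\lambda))_{\lambda\in b\mathbb Z}$ with entries in $\{0,1\}$ and $\mathbf x(0)=1$. $\mathbf 1$ denotes the vector indexed by $a\mathbb Z$ with all entries $1$. $\mathcal S_{a,b,c}=\{t:\mathbf M_{a,b,c}(t)\mathbf x=\mathbf 1\text{ for some }\mathbf x\in\mathcal B_b^0\}$. $\#$ denotes cardinality and $A+r\mathbb Z=\{x+rk:x\in A,k\in\mathbb Z\}$. For positive $x,y$ in the lattice $(b/q)\mathbb Z$, $\gcd(x,y)$ is the largest $d\in(b/q)\mathbb Z$, $d>0$, with $x,y\in d\mathbb Z$. *)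

(* Defs.v *)
From Stdlib Require Export Reals Lra Lia ZArith List.
Open Scope R_scope.

Definition floorZ (x : R) : Z := Int_part x.

Definition in_mult (x d : R) : Prop := exists k : Z, x = IZR k * d.

Definition chi (c s : R) : R := if Rle_dec 0 s then (if Rlt_dec s c then 1 else 0) else 0.

(* (M_{a,b,c}(t) x)(μ) = 1 for μ = m a, where x : Z -> bool encodes the
   {0,1}-vector indexed by bZ (x k is the entry at λ = k b).  Since the entries
   are 0/1 and only finitely many terms are nonzero, the sum equals 1 iff
   exactly one λ = k b has x(λ)=1 and χ_[0,c)(t-μ+λ)=1. *)
Definition row_sum_is_one (a b c t : R) (x : Z -> bool) (m : Z) : Prop :=
  exists! k : Z, x k = true /\ chi c (t - IZR m * a + IZR k * b) = 1.

Definition in_S (a b c t : R) : Prop :=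
  exists x : Z -> bool, x 0%Z = true /\ forall m : Z, row_sum_is_one a b c t x m.

Definition is_lat_gcd (b : R) (q : Z) (x y d : R) : Prop :=
  0 < d /\ in_mult d (b / IZR q) /\ in_mult x d /\ in_mult y d /\
  forall e, 0 < e -> in_mult e (b / IZR q) -> in_mult x e -> in_mult y e -> e <= d.

Definition card_is (P : nat -> Prop) (n : nat) : Prop :=
  exists l : list nat, NoDup l /\ (forall k, In k l <-> P k) /\ length l = n.

(* Main.v *)
Require Import Defs.
From Stdlib Require Import Reals Lra Lia ZArith List.
From Stdlib Require Import Classical ClassicalEpsilon FinFun Sorted Bool.

(** After rescaling by b/q everything is integral. Let h = b - a. If l < l' are
    consecutive selected points of t + bZ, the window condition says that
    floor((l' - c)/a) = floor(l/a), so l' is determined by l: modulo a, the successor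
    map translates [0, c0 - h) by c1 + h, translates [c0, a) by c1, and is undefined on
    the hole [c0 - h, c0). Hence S is nonempty iff this map has a cycle.

    The map preserves the cyclic order, so on a cycle of N points, numbered in
    increasing order, it is a rotation i |-> i + r with r prime to N. A cycle on one
    side of the hole has constant gaps and gives cases 1) and 2). Otherwise the gap
    across 0 grows by h and the gap across the hole shrinks by h, all other gaps being
    transported unchanged; so the gaps are g and g + h, the long ones sitting at
    -1 + n r for 1 <= n <= n1, where n1 r = nL modulo N and nL is the number of points
    to the left of the hole. This is case 3) with d1 + d2 + 1 = n1, d1 + d3 + 1 = nL,
    B_d = N g and X = r a. Conversely these data determine the points, and summing the
    displacements over one period identifies the rotation with the map. *)

(** * The successor map and its cycles *)

Local Open Scope Z_scope.

(* The successor map uses w = c0 - h, u = (K + 1) b and v = K b; modulo a these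
   translations are c1 + h and c1, and with the latter the map is increasing. On the
   hole, i.e. off [safe], the value is junk. *)
Definition step (a w u v y : Z) : Z := if y mod a <? w then y + u else y + v.

Definition orbit (a w u v : Z) (n : nat) (y : Z) : Z := Nat.iter n (step a w u v) y.

Definition safe (a w c0 y : Z) : Prop := y mod a < w \/ c0 <= y mod a.

(** The orbit is followed in Z and closes up only modulo a: the lift keeps the order of the points
    and, for u = (K + 1) b and v = K b, consists of selected points themselves. Safety is asked at
    every time, so the whole orbit avoids the hole. *)
Definition has_cycle (a w c0 u v : Z) : Prop :=
  exists (y : Z) (N : nat), (0 < N)%nat /\ (a | orbit a w u v N y - y) /\
    forall i, safe a w c0 (orbit a w u v i y).

Lemma mod_eq_of_divide (a x y : Z) : (a | x - y) -> x mod a = y mod a.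
Proof.
  intros [k H]. replace x with (y + k * a) by lia. apply Z_mod_plus_full.
Qed.

Lemma divide_of_mod_eq (a x y : Z) : x mod a = y mod a -> (a | x - y).
Proof.
  intros H. destruct (Z.eq_dec a 0) as [->|Ha].
  - rewrite !Zmod_0_r in H. subst. exists 0. lia.
  - exists (x / a - y / a).
    pose proof (Z_div_mod_eq_full x a). pose proof (Z_div_mod_eq_full y a). nia.
Qed.

Lemma step_congr (a w u v u' v' y y' : Z) :
  (a | u - u') -> (a | v - v') -> (a | y - y') ->
  (a | step a w u v y - step a w u' v' y').
Proof.
  intros Hu Hv Hy. unfold step. rewrite (mod_eq_of_divide _ _ _ Hy).
  destruct (y' mod a <? w).
  - replace (y + u - (y' + u')) with ((y - y') + (u - u')) by lia.
    now apply Z.divide_add_r.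
  - replace (y + v - (y' + v')) with ((y - y') + (v - v')) by lia.
    now apply Z.divide_add_r.
Qed.

Lemma orbit_congr (a w u v u' v' y y' : Z) (n : nat) :
  (a | u - u') -> (a | v - v') -> (a | y - y') ->
  (a | orbit a w u v n y - orbit a w u' v' n y').
Proof.
  intros Hu Hv Hy. induction n as [|n IH]; simpl; auto. now apply step_congr.
Qed.

(** This passes between the true displacements of the selected points and their reductions c1 + h
    and c1, for which the map is increasing. *)
Lemma has_cycle_congr (a w c0 u v u' v' : Z) :
  (a | u - u') -> (a | v - v') -> has_cycle a w c0 u v -> has_cycle a w c0 u' v'.
Proof.
  intros Hu Hv (y & N & HN & Hc & Hs). exists y, N.
  assert (Hyy : (a | y - y)) by (exists 0; lia).
  pose proof (fun n => orbit_congr a w u v u' v' y y n Hu Hv Hyy) as HO.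
  split; [easy|split].
  - replace (orbit a w u' v' N y - y)
      with ((orbit a w u v N y - y) - (orbit a w u v N y - orbit a w u' v' N y)) by lia.
    now apply Z.divide_sub_r.
  - intros i. specialize (Hs i). unfold safe in *.
    now rewrite <- (mod_eq_of_divide _ _ _ (HO i)).
Qed.

Lemma step_add_mul (a w u v y m : Z) :
  step a w u v (y + m * a) = step a w u v y + m * a.
Proof. unfold step. rewrite Z_mod_plus_full. destruct (y mod a <? w); lia. Qed.

Lemma orbit_plus (a w u v y : Z) (m n : nat) :
  orbit a w u v (m + n) y = orbit a w u v m (orbit a w u v n y).
Proof. induction m as [|m IH]; simpl; congruence. Qed.

(** * Tilings and cycles *)

Lemma pigeonhole_mod (a : Z) (f : nat -> Z) :
  0 < a -> exists i j : nat, (i < j)%nat /\ f i mod a = f j mod a.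
Proof.
  intros Ha. apply NNPP. intros Hno.
  assert (Hinj : NoDup (map (fun i => f i mod a) (seq 0 (S (Z.to_nat a))))).
  { apply Injective_map_NoDup_in; [|apply seq_NoDup].
    intros i j _ _ Hij. destruct (Nat.lt_trichotomy i j) as [H|[H|H]]; auto;
      exfalso; apply Hno; eauto. }
  apply NoDup_incl_length with (l' := map Z.of_nat (seq 0 (Z.to_nat a))) in Hinj.
  - rewrite !length_map, !length_seq in Hinj. lia.
  - intros z Hz. apply in_map_iff in Hz. destruct Hz as (i & <- & _).
    pose proof (Z.mod_pos_bound (f i) a Ha).
    apply in_map_iff. exists (Z.to_nat (f i mod a)). split; [lia|].
    apply in_seq. lia.
Qed.

(* Sampling grid rescaled so that b/q = 1; here a = p, b = q and c = k. *)
Definition tiling (p q k t : Z) (x : Z -> bool) : Prop :=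
  x 0 = true /\
  forall m : Z, exists! j : Z, x j = true /\ 0 <= t - m * p + j * q < k.

(* Consecutive selected points l < l' satisfy floor(l/p) = floor((l'-k)/p), which
   forces l' = step l. *)
Lemma cycle_of_tiling (p q K c0 t : Z) (x : Z -> bool) :
  0 < p -> p < q -> 1 <= K -> q - p < c0 -> c0 < p ->
  tiling p q (K * q + c0) t x ->
  has_cycle p (c0 - (q - p)) c0 ((K + 1) * q) (K * q).
Proof.
  intros Hp Hpq HK Hc0 Hc0' [Hx0 Hrow].
  set (w := c0 - (q - p)). set (F := step p w ((K + 1) * q) (K * q)).
  set (L := fun l => exists j, x j = true /\ l = t + j * q).
  assert (Hnext : forall l, L l -> safe p w c0 l /\ L (F l)).
  { intros l (j & Hj & Hl).
    pose proof (Z.mod_pos_bound l p Hp) as Hs. pose proof (Z_div_mod_eq_full l p) as Hd.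
    set (m0 := l / p) in *. set (s := l mod p) in *.
    (* Row m0 is the last one whose window contains l, so row m0 + 1 is served by another point j'.
       That point cannot serve row m0 as well, so it lies beyond the window of m0 by less than p.
       This leaves the jumps K, forcing s >= c0, and K + 1, forcing s < w. *)
    destruct (Hrow (m0 + 1)) as (j' & (Hj' & Hw) & _).
    assert (Hout : ~ (0 <= t - m0 * p + j' * q < K * q + c0)).
    { intros Hin. destruct (Hrow m0) as (j'' & _ & Hu).
      assert (E1 := Hu j' (conj Hj' Hin)).
      assert (E2 : j'' = j). { apply Hu. split; auto. nia. }
      assert (j' = j) by congruence. subst j'. lia. }
    assert (Hi : K * q + c0 <= s + (j' - j) * q < K * q + c0 + p) by lia.
    assert (Hcase : j' - j = K \/ j' - j = K + 1).
    { assert (K <= j' - j) by nia. assert (j' - j < K + 2) by nia. lia. }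
    assert (HF : F l = if s <? w then l + (K + 1) * q else l + K * q) by reflexivity.
    destruct Hcase as [E|E]; rewrite E in Hi.
    - assert (c0 <= s) by lia. split; [right; auto|].
      rewrite HF. destruct (Z.ltb_spec s w); [unfold w in *; lia|].
      exists j'. split; auto. rewrite Hl. replace j' with (j + K) by lia. ring.
    - assert (s < w) by (unfold w; lia). split; [left; auto|].
      rewrite HF. destruct (Z.ltb_spec s w); [|lia].
      exists j'. split; auto. rewrite Hl. replace j' with (j + (K + 1)) by lia. ring. }
  assert (HL : forall n, L (orbit p w ((K + 1) * q) (K * q) n t)).
  { induction n as [|n IH].
    - exists 0. split; auto. simpl. lia.
    - simpl. now apply Hnext. }
  (* The orbit of t consists of selected points; two of them agree modulo p, and the cycle starts at
     the earlier one. *)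
  destruct (pigeonhole_mod p (fun n => orbit p w ((K + 1) * q) (K * q) n t) Hp)
    as (i & j & Hij & E).
  exists (orbit p w ((K + 1) * q) (K * q) i t), (j - i)%nat.
  split; [lia|split].
  - rewrite <- orbit_plus. replace (j - i + i)%nat with j by lia.
    now apply divide_of_mod_eq.
  - intros n. rewrite <- orbit_plus. now apply Hnext.
Qed.

(** Each step gains at least one, so [f] is unbounded in both directions and the intervals ]f (n -
    1), f n] tile Z. This serves twice: to find the selected point of a row, and to find the first
    point to the right of the hole. *)
Lemma increasing_locate (f : Z -> Z) :
  (forall n, f (n - 1) + 1 <= f n) ->
  forall m, exists! n, f (n - 1) < m <= f n.
Proof.
  intros Hf m.
  assert (Hk : forall k n, 0 <= k -> f n + k <= f (n + k)).
  { intros k n Hk. revert k Hk. apply natlike_ind.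
    - rewrite !Z.add_0_r. lia.
    - intros k Hk IH. specialize (Hf (n + Z.succ k)).
      replace (n + Z.succ k - 1) with (n + k) in Hf by lia. lia. }
  assert (Hex : forall k : nat, forall n, m <= f n -> f n - m <= Z.of_nat k ->
            exists n, f (n - 1) < m <= f n).
  { induction k as [|k IH]; intros n H1 H2.
    - exists n. specialize (Hf n). lia.
    - destruct (Z.lt_ge_cases (f (n - 1)) m) as [H|H].
      + exists n. lia.
      + apply (IH (n - 1)); auto. specialize (Hf n). lia. }
  set (n0 := Z.max 0 (m - f 0)).
  assert (H0 : m <= f n0).
  { specialize (Hk n0 0 ltac:(lia)). rewrite Z.add_0_l in Hk. lia. }
  destruct (Hex (Z.to_nat (f n0 - m)) n0 H0 ltac:(lia)) as (n & Hn).
  exists n. split; auto.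
  intros n' Hn'. destruct (Z.lt_trichotomy n n') as [H|[H|H]]; auto; exfalso.
  - specialize (Hk (n' - 1 - n) n ltac:(lia)).
    replace (n + (n' - 1 - n)) with (n' - 1) in Hk by lia. lia.
  - specialize (Hk (n - 1 - n') n' ltac:(lia)).
    replace (n' + (n - 1 - n')) with (n - 1) in Hk by lia. lia.
Qed.

(** The cycle is unrolled into a bi-infinite sequence of points, which are the selected ones. Each
    point serves an interval of rows that begins just after the last row of its predecessor, so
    every row is served exactly once. *)
Lemma tiling_of_cycle (p q K c0 : Z) :
  0 < p -> p < q -> 1 <= K -> q - p < c0 -> c0 < p ->
  has_cycle p (c0 - (q - p)) c0 ((K + 1) * q) (K * q) ->
  exists t x, tiling p q (K * q + c0) t x.
Proof.
  intros Hp Hpq HK Hc0 Hc0' (y & N & HN & [M HM] & Hs).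
  set (w := c0 - (q - p)) in *.
  set (orb := fun n => orbit p w ((K + 1) * q) (K * q) n y) in *.
  set (ZN := Z.of_nat N).
  (* One turn of N steps moves the orbit by M p; repeating this period extends the orbit to negative
     times. *)
  set (lam := fun z => orb (Z.to_nat (z mod ZN)) + (z / ZN) * (M * p)).
  assert (Hlam0 : lam 0 = y).
  { unfold lam. rewrite Zmod_0_l, Zdiv_0_l. simpl. lia. }
  assert (Hsafe : forall z, safe p w c0 (lam z)).
  { intros z. unfold safe, lam. rewrite Z.mul_assoc, Z_mod_plus_full. apply Hs. }
  assert (Hstep : forall z, lam (z + 1) = step p w ((K + 1) * q) (K * q) (lam z)).
  { intros z. unfold lam at 2. rewrite Z.mul_assoc, step_add_mul.
    change (step p w ((K + 1) * q) (K * q) (orb (Z.to_nat (z mod ZN))))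
      with (orb (S (Z.to_nat (z mod ZN)))).
    pose proof (Z.mod_pos_bound z ZN ltac:(lia)).
    pose proof (Z_div_mod_eq_full z ZN).
    destruct (Z.eq_dec (z mod ZN) (ZN - 1)) as [E|E].
    - assert (D : (z + 1) / ZN = z / ZN + 1).
      { symmetry. apply (Z.div_unique_pos _ _ _ 0); lia. }
      assert (R : (z + 1) mod ZN = 0).
      { symmetry. apply (Z.mod_unique_pos _ _ (z / ZN + 1) 0); lia. }
      unfold lam. rewrite D, R.
      replace (S (Z.to_nat (z mod ZN))) with N by lia.
      replace (orb N) with (y + M * p) by (unfold orb; lia).
      change (orb (Z.to_nat 0)) with y. ring.
    - assert (D : (z + 1) / ZN = z / ZN).
      { symmetry. apply (Z.div_unique_pos _ _ _ (z mod ZN + 1)); lia. }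
      assert (R : (z + 1) mod ZN = z mod ZN + 1).
      { symmetry. apply (Z.mod_unique_pos _ _ (z / ZN) _); lia. }
      unfold lam. rewrite D, R.
      replace (Z.to_nat (z mod ZN + 1)) with (S (Z.to_nat (z mod ZN))) by lia. ring. }
  assert (Horb : forall n, exists j, orb n = y + j * q).
  { induction n as [|n [j IH]].
    - exists 0. unfold orb. simpl. lia.
    - change (orb (S n)) with (step p w ((K + 1) * q) (K * q) (orb n)).
      unfold step. rewrite IH. destruct (_ <? _).
      + exists (j + (K + 1)). ring.
      + exists (j + K). ring. }
  assert (Hq : forall z, exists j, lam z = y + j * q).
  { intros z. unfold lam. destruct (Horb (Z.to_nat (z mod ZN))) as [j ->].
    destruct (Horb N) as [jN HjN]. unfold orb in HjN at 1.
    (* The displacement M p of a full turn is also a sum of jumps in q Z, so the extended orbit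
       stays in y + q Z. *)
    assert (M * p = jN * q) as -> by lia.
    exists (j + z / ZN * jN). ring. }
  (* the windows containing lam z are those with lam (z-1) / p < m <= lam z / p *)
  assert (Hwin : forall z, K * q + c0 + p * (lam (z - 1) / p) <= lam z
                           < K * q + c0 + p * (lam (z - 1) / p) + p).
  { intros z. specialize (Hstep (z - 1)). replace (z - 1 + 1) with z in Hstep by lia.
    rewrite Hstep. specialize (Hsafe (z - 1)). unfold step, safe in *.
    pose proof (Z.mod_pos_bound (lam (z - 1)) p Hp).
    pose proof (Z_div_mod_eq_full (lam (z - 1)) p).
    destruct (Z.ltb_spec (lam (z - 1) mod p) w); unfold w in *; lia. }
  assert (Hdiv : forall z, p * (lam z / p) <= lam z < p * (lam z / p) + p).
  { intros z. pose proof (Z.mod_pos_bound (lam z) p Hp).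
    pose proof (Z_div_mod_eq_full (lam z) p). lia. }
  assert (Hmem : forall z m, 0 <= lam z - m * p < K * q + c0 <->
                             lam (z - 1) / p < m <= lam z / p).
  { intros z m. specialize (Hwin z). pose proof (Hdiv z). split; intros; nia. }
  assert (Hinc : forall n, lam (n - 1) / p + 1 <= lam n / p).
  { intros n. specialize (Hwin n). pose proof (Hdiv n). nia. }
  exists y.
  exists (fun j => if excluded_middle_informative (exists z, lam z = y + j * q)
                   then true else false).
  split.
  - destruct (excluded_middle_informative _) as [|Hn]; auto.
    exfalso. apply Hn. exists 0. lia.
  - intros m. destruct (increasing_locate (fun z => lam z / p) Hinc m) as (n & Hn & Hu).
    destruct (Hq n) as [j Hj]. exists j. split.
    + split.
      * destruct (excluded_middle_informative _) as [|Hno]; auto.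
        exfalso. apply Hno. eauto.
      * apply Hmem in Hn. lia.
    + intros j' [Hj' Hw].
      destruct (excluded_middle_informative _) as [[z Hz]|]; [|discriminate].
      assert (n = z) as <-. { apply Hu. apply Hmem. lia. }
      rewrite Hj in Hz. nia.
Qed.

(** * A cycle as a rotation *)

Lemma StronglySorted_filter (A : Type) (R : A -> A -> Prop) (f : A -> bool) (l : list A) :
  StronglySorted R l -> StronglySorted R (filter f l).
Proof.
  induction 1 as [|x l Hl IH Hx]; simpl; [constructor|].
  destruct (f x); auto. constructor; auto.
  rewrite Forall_forall in *. intros y Hy. apply filter_In in Hy. now apply Hx.
Qed.

Lemma StronglySorted_nth (A : Type) (R : A -> A -> Prop) (d : A) (l : list A) :
  StronglySorted R l ->
  forall i j, (i < j < length l)%nat -> R (nth i l d) (nth j l d).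
Proof.
  induction 1 as [|x l Hl IH Hx]; simpl; intros i j Hij; [lia|].
  destruct j as [|j]; [lia|]. destruct i as [|i].
  - rewrite Forall_forall in Hx. apply Hx. apply nth_In. lia.
  - apply IH. lia.
Qed.

Lemma StronglySorted_iota (m n : nat) :
  StronglySorted Z.lt (map Z.of_nat (seq m n)).
Proof.
  revert m. induction n as [|n IH]; intros m; simpl; constructor; auto.
  rewrite Forall_forall. intros z Hz. apply in_map_iff in Hz.
  destruct Hz as (k & <- & Hk). apply in_seq in Hk. lia.
Qed.

(** The elements of [P] in [0, a) are listed in increasing order and the list is continued by
    translation by a. Index 0 goes to the first nonnegative element, so that the left points will
    come first in each period. *)
Lemma periodic_enumeration (a : Z) (P : Z -> Prop) :
  0 < a -> (exists z, P z) -> (forall z m, P z -> P (z + m * a)) ->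
  exists (N : Z) (x : Z -> Z),
    0 < N /\ (forall i, x i < x (i + 1)) /\ (forall i, x (i + N) = x i + a) /\
    (forall i, P (x i)) /\ (forall z, P z -> exists i, x i = z) /\
    0 <= x 0 /\ x (-1) < 0.
Proof.
  intros Ha [z0 Hz0] Hper.
  set (f := fun z => if excluded_middle_informative (P z) then true else false).
  set (l := filter f (map Z.of_nat (seq 0 (Z.to_nat a)))).
  assert (Hin : forall z, In z l <-> P z /\ 0 <= z < a).
  { intros z. unfold l. rewrite filter_In, in_map_iff. unfold f.
    destruct (excluded_middle_informative (P z)) as [H|H]; split.
    - intros [(k & <- & Hk) _]. apply in_seq in Hk. split; auto; lia.
    - intros [_ Hz]. split; auto. exists (Z.to_nat z). split; [lia|].
      apply in_seq. lia.
    - intros [_ ?]. discriminate.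
    - tauto. }
  assert (Hred : forall z, P z -> In (z mod a) l).
  { intros z Hz. apply Hin. split.
    - replace (z mod a) with (z + - (z / a) * a)
        by (pose proof (Z_div_mod_eq_full z a); lia). now apply Hper.
    - now apply Z.mod_pos_bound. }
  set (N := Z.of_nat (length l)).
  assert (HN : 0 < N).
  { specialize (Hred z0 Hz0). unfold N. destruct l; simpl in *; [tauto|lia]. }
  assert (Hnth : forall i, 0 <= i < N -> In (nth (Z.to_nat i) l 0) l).
  { intros i Hi. apply nth_In. lia. }
  assert (Hmono : forall i j, 0 <= i -> i < j -> j < N ->
            nth (Z.to_nat i) l 0 < nth (Z.to_nat j) l 0).
  { intros i j H1 H2 H3. apply StronglySorted_nth; [|lia].
    apply StronglySorted_filter, StronglySorted_iota. }
  set (x := fun i => nth (Z.to_nat (i mod N)) l 0 + (i / N) * a).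
  exists N, x. split; [easy|].
  assert (Hb : forall i, 0 <= nth (Z.to_nat (i mod N)) l 0 < a).
  { intros i. apply Hin, Hnth. now apply Z.mod_pos_bound. }
  split; [|split; [|split; [|split; [|split]]]].
  - intros i. pose proof (Z.mod_pos_bound i N HN) as Hr.
    pose proof (Z_div_mod_eq_full i N) as Hd.
    destruct (Z.eq_dec (i mod N) (N - 1)) as [E|E].
    + assert (D : (i + 1) / N = i / N + 1).
      { symmetry. apply (Z.div_unique_pos _ _ _ 0); lia. }
      unfold x. rewrite D. pose proof (Hb i). pose proof (Hb (i + 1)). nia.
    + assert (D : (i + 1) / N = i / N).
      { symmetry. apply (Z.div_unique_pos _ _ _ (i mod N + 1)); lia. }
      assert (R : (i + 1) mod N = i mod N + 1).
      { symmetry. apply (Z.mod_unique_pos _ _ (i / N) _); lia. }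
      unfold x. rewrite D, R.
      pose proof (Hmono (i mod N) (i mod N + 1)). lia.
  - intros i. unfold x. replace (i + N) with (i + 1 * N) by lia.
    rewrite Z_mod_plus_full, Z_div_plus_full by lia. ring.
  - intros i. unfold x. apply Hper. apply Hin, Hnth. now apply Z.mod_pos_bound.
  - intros z Hz. destruct (In_nth _ _ 0 (Hred z Hz)) as (n & Hn & E).
    exists (Z.of_nat n + (z / a) * N). unfold x.
    rewrite Z_mod_plus_full, Z_div_plus_full by lia.
    rewrite Z.mod_small, Z.div_small by lia. rewrite Nat2Z.id, E.
    pose proof (Z_div_mod_eq_full z a). lia.
  - unfold x. rewrite Zdiv_0_l. pose proof (Hb 0). lia.
  - unfold x. pose proof (Hb (-1)).
    assert (-1 / N = -1) as ->; [|lia].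
    symmetry. apply (Z.div_unique_pos _ _ _ (N - 1)); lia.
Qed.

Lemma increasing_lt (x : Z -> Z) :
  (forall i, x i < x (i + 1)) -> forall i j, i < j -> x i < x j.
Proof.
  intros Hx i j Hij.
  assert (H : forall k, 0 <= k -> x i <= x (i + k) - k).
  { apply natlike_ind.
    - rewrite Z.add_0_r. lia.
    - intros k Hk IH. specialize (Hx (i + k)).
      replace (i + Z.succ k) with (i + k + 1) by lia. lia. }
  specialize (H (j - i) ltac:(lia)). replace (i + (j - i)) with j in H by lia. lia.
Qed.

Lemma increasing_lt_inv (x : Z -> Z) :
  (forall i, x i < x (i + 1)) -> forall i j, x i < x j -> i < j.
Proof.
  intros Hx i j Hij. destruct (Z.lt_trichotomy i j) as [H|[H|H]]; auto.
  - subst. lia.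
  - apply (increasing_lt x Hx) in H. lia.
Qed.

Lemma increasing_inj (x : Z -> Z) :
  (forall i, x i < x (i + 1)) -> forall i j, x i = x j -> i = j.
Proof.
  intros Hx i j Hij. destruct (Z.lt_trichotomy i j) as [H|[H|H]]; auto;
  apply (increasing_lt x Hx) in H; lia.
Qed.

(** An order automorphism of Z is a translation. Consecutive points go to consecutive points: if [T]
    skipped x (j + 1), the preimage of that point would lie strictly between x i and x (i + 1). *)
Lemma order_automorphism_shift (x T : Z -> Z) :
  (forall i, x i < x (i + 1)) ->
  (forall i j, i < j -> T (x i) < T (x j)) ->
  (forall i, exists j, T (x i) = x j) -> (forall j, exists i, T (x i) = x j) ->
  exists r, forall i, T (x i) = x (i + r).
Proof.
  intros Hx HT Hto Hfrom.
  assert (Hinv : forall i j, T (x i) < T (x j) -> i < j).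
  { intros i j Hij. destruct (Z.lt_trichotomy i j) as [H|[->|H]]; auto; [lia|].
    apply HT in H. lia. }
  assert (Hsucc : forall i j, T (x i) = x j -> T (x (i + 1)) = x (j + 1)).
  { intros i j E. destruct (Hto (i + 1)) as [k Hk].
    assert (j < k).
    { apply (increasing_lt_inv x Hx). rewrite <- E, <- Hk. apply HT. lia. }
    destruct (Z.eq_dec k (j + 1)) as [->|Hne]; auto. exfalso.
    destruct (Hfrom (j + 1)) as [l Hl].
    assert (i < l). { apply Hinv. rewrite E, Hl. apply Hx. }
    assert (l < i + 1).
    { apply Hinv. rewrite Hk, Hl. apply increasing_lt; auto. lia. }
    lia. }
  destruct (Hto 0) as [r Hr]. exists r. intros i.
  induction i as [|i IH|i IH] using Z.peano_ind.
  - exact Hr.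
  - apply Hsucc in IH. replace (Z.succ i + r) with (i + r + 1) by lia. exact IH.
  - destruct (Hto (Z.pred i)) as [k Hk]. pose proof (Hsucc _ _ Hk) as Hk'.
    replace (Z.pred i + 1) with i in Hk' by lia. rewrite Hk' in IH.
    apply (increasing_inj x Hx) in IH. rewrite Hk. f_equal. lia.
Qed.

(** Distance is lost only when the smaller point lies left of the hole and the larger one right of
    it. The loss is h, and such points are more than h apart because the hole lies between them. *)
Lemma step_increasing (a h c0 c1 x y : Z) :
  0 < a -> 0 <= h -> h <= c0 -> c0 <= a ->
  safe a (c0 - h) c0 x -> safe a (c0 - h) c0 y -> x < y ->
  step a (c0 - h) (c1 + h) c1 x < step a (c0 - h) (c1 + h) c1 y.
Proof.
  intros Ha Hh Hhc Hca Sx Sy Hxy. unfold step, safe in *.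
  pose proof (Z.mod_pos_bound x a Ha). pose proof (Z_div_mod_eq_full x a).
  pose proof (Z.mod_pos_bound y a Ha). pose proof (Z_div_mod_eq_full y a).
  destruct (Z.ltb_spec (x mod a) (c0 - h)), (Z.ltb_spec (y mod a) (c0 - h)); try lia.
  assert (x / a <= y / a) by (apply Z.div_le_mono; lia).
  assert (x / a = y / a \/ x / a + 1 <= y / a) by lia. nia.
Qed.

(* Squeezing out the complement of a cycle turns the map into a rotation: numbering
   the points of the cycle in increasing order, the map is i |-> i + r. *)
Lemma cycle_rotation (a h c0 c1 : Z) :
  0 < a -> 0 <= h -> h <= c0 -> c0 <= a ->
  has_cycle a (c0 - h) c0 (c1 + h) c1 ->
  exists (N r s : Z) (x : Z -> Z),
    0 < N /\ (N | s * r - 1) /\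
    (forall i, x i < x (i + 1)) /\ (forall i, x (i + N) = x i + a) /\
    (forall i, step a (c0 - h) (c1 + h) c1 (x i) = x (i + r)) /\
    (forall i, safe a (c0 - h) c0 (x i)) /\
    0 <= x 0 /\ x (-1) < 0.
Proof.
  intros Ha Hh Hhc Hca (y & n & Hn & [M HM] & Hs).
  set (T := step a (c0 - h) (c1 + h) c1).
  set (orb := orbit a (c0 - h) (c1 + h) c1) in *.
  set (P := fun z => exists j m, z = orb j y + m * a).
  assert (HP : exists z, P z). { exists y, 0%nat, 0. simpl. lia. }
  assert (Hper : forall z m, P z -> P (z + m * a)).
  { intros z m (j & m' & ->). exists j, (m' + m). ring. }
  assert (HPT : forall z, P z -> P (T z)).
  { intros z (j & m & ->). exists (S j), m. apply step_add_mul. }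
  assert (HTP : forall z, P z -> exists z', P z' /\ T z' = z).
  { intros z (j & m & ->). destruct j as [|j].
    (* The start of the cycle is the image of the last point of the turn, once the displacement M a
       is undone. *)
    - exists (orb (n - 1)%nat y + (m - M) * a). split; [exists (n - 1)%nat, (m - M); auto|].
      unfold T. rewrite step_add_mul.
      change (step a (c0 - h) (c1 + h) c1 (orb (n - 1)%nat y)) with (orb (S (n - 1))%nat y).
      replace (S (n - 1)) with n by lia. simpl. lia.
    - exists (orb j y + m * a). split; [exists j, m; auto|]. apply step_add_mul. }
  assert (Hsafe : forall z, P z -> safe a (c0 - h) c0 z).
  { intros z (j & m & ->). unfold safe. rewrite Z_mod_plus_full. apply Hs. }
  destruct (periodic_enumeration a P Ha HP Hper) as (N & x & HN & Hx & HxN & HPx & Hsurj & H0 & H1).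
  destruct (order_automorphism_shift x T) as [r Hr]; auto.
  { intros i j Hij. apply step_increasing; auto. now apply increasing_lt. }
  { intros i. destruct (Hsurj (T (x i))) as [j Hj]; auto. eauto. }
  { intros j. destruct (HTP (x j)) as (z & Hz & E); auto.
    destruct (Hsurj z Hz) as [i <-]. eauto. }
  assert (HxM : forall i m, x (i + m * N) = x i + m * a).
  { intros i m. induction m as [|m IH|m IH] using Z.peano_ind.
    - rewrite !Z.mul_0_l, !Z.add_0_r. easy.
    - replace (i + Z.succ m * N) with (i + m * N + N) by lia. rewrite HxN, IH. lia.
    - specialize (HxN (i + Z.pred m * N)).
      replace (i + Z.pred m * N + N) with (i + m * N) in HxN by lia. lia. }
  assert (Horb : forall j i, orb j (x i) = x (i + Z.of_nat j * r)).
  { induction j as [|j IH]; intros i.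
    - simpl. now rewrite Z.add_0_r.
    - change (orb (S j) (x i)) with (T (orb j (x i))). rewrite IH, Hr. f_equal. lia. }
  destruct (Hsurj y) as [iy Hiy]. { exists 0%nat, 0. simpl. lia. }
  (* The point following y in the enumeration is also on the orbit modulo a, which reads 1 = j r + m
     N; hence j is an inverse of r modulo N. *)
  destruct (HPx (iy + 1)) as (j & m & E).
  rewrite <- Hiy, Horb, <- HxM in E. apply (increasing_inj x Hx) in E.
  exists N, r, (Z.of_nat j), x. repeat split; auto.
  exists (- m). lia.
Qed.

(** * Counting and summing over a period *)

Fixpoint count (f : Z -> bool) (n : nat) : nat :=
  match n with
  | O => O
  | S m => (count f m + if f (Z.of_nat m) then 1 else 0)%nat
  end.

Fixpoint zsum (f : Z -> Z) (n : nat) : Z :=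
  match n with
  | O => 0
  | S m => zsum f m + f (Z.of_nat m)
  end.

Lemma count_lipschitz (f : Z -> bool) (m n : nat) :
  (m <= n)%nat -> (count f m <= count f n <= count f m + (n - m))%nat.
Proof.
  induction 1 as [|n Hmn IH]; cbn [count]; [lia|]. destruct (f (Z.of_nat n)); lia.
Qed.

Lemma card_is_count (f : Z -> bool) (n : nat) :
  card_is (fun i => (i < n)%nat /\ f (Z.of_nat i) = true) (count f n).
Proof.
  induction n as [|n (l & Hl & Hin & Hlen)]; simpl.
  - exists nil. split; [constructor|split; auto]. intros k; simpl. lia.
  - destruct (f (Z.of_nat n)) eqn:E.
    + exists (n :: l). split; [|split].
      * constructor; auto. rewrite Hin. lia.
      * intros k. simpl. rewrite Hin. split.
        -- intros [<-|[H1 H2]]; split; auto.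
        -- intros [H1 H2]. destruct (Nat.eq_dec k n); [left; auto|right; split; auto; lia].
      * simpl. lia.
    + exists l. split; [auto|split; [|lia]].
      intros k. rewrite Hin. split; intros [H1 H2]; split; auto.
      destruct (Nat.eq_dec k n); [congruence|lia].
Qed.

Lemma card_is_bijection (P Q : nat -> Prop) (f : nat -> nat) (n : nat) :
  (forall i, P i -> Q (f i)) ->
  (forall i j, P i -> P j -> f i = f j -> i = j) ->
  (forall k, Q k -> exists i, P i /\ f i = k) ->
  card_is P n -> card_is Q n.
Proof.
  intros Hto Hinj Hsurj (l & Hl & Hin & Hlen). exists (map f l). split; [|split].
  - apply Injective_map_NoDup_in; auto.
    intros i j Hi Hj. apply Hinj; now apply Hin.
  - intros k. rewrite in_map_iff. split.
    + intros (i & <- & Hi). now apply Hto, Hin.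
    + intros Hk. destruct (Hsurj k Hk) as (i & Hi & E). exists i.
      split; auto. now apply Hin.
  - now rewrite length_map.
Qed.

Lemma card_is_ext (P Q : nat -> Prop) (n : nat) :
  (forall i, P i <-> Q i) -> card_is P n -> card_is Q n.
Proof.
  intros H (l & Hl & Hin & Hlen). exists l. split; [auto|split; [|auto]].
  intros k. rewrite Hin. apply H.
Qed.

Lemma card_is_unique (P : nat -> Prop) (m n : nat) :
  card_is P m -> card_is P n -> m = n.
Proof.
  intros (l & Hl & Hin & <-) (l' & Hl' & Hin' & <-).
  apply Nat.le_antisymm; apply NoDup_incl_length; auto; intros k Hk.
  - now apply Hin', Hin.
  - now apply Hin, Hin'.
Qed.

Lemma card_is_interval (n : nat) : card_is (fun i => (1 <= i <= n)%nat) n.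
Proof.
  exists (seq 1 n). split; [apply seq_NoDup|split; [|apply length_seq]].
  intros k. rewrite in_seq. lia.
Qed.

Lemma zsum_shift (f : Z -> Z) (n : nat) :
  zsum (fun i => f (i + 1)) n = zsum f n + f (Z.of_nat n) - f 0.
Proof.
  induction n as [|n IH]; [simpl; lia|].
  cbn [zsum]. rewrite IH, Nat2Z.inj_succ. unfold Z.succ. lia.
Qed.

Lemma zsum_sub (f g : Z -> Z) (n : nat) :
  zsum (fun i => f i - g i) n = zsum f n - zsum g n.
Proof. induction n as [|n IH]; simpl; lia. Qed.

Lemma zsum_ext (f g : Z -> Z) (n : nat) :
  (forall i, f i = g i) -> zsum f n = zsum g n.
Proof. intros H. induction n as [|n IH]; simpl; congruence. Qed.

(** Sliding a window of n consecutive terms by one place replaces a term by its translate by a, so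
    the sum gains a for each unit of r. It gives the total displacement of a rotation over one
    period. *)
Lemma zsum_translate (x : Z -> Z) (a r : Z) (n : nat) :
  (forall i, x (i + Z.of_nat n) = x i + a) ->
  zsum (fun i => x (i + r) - x i) n = r * a.
Proof.
  intros Hx. rewrite zsum_sub.
  assert (Hs : forall r, zsum (fun i => x (i + (r + 1))) n
                         = zsum (fun i => x (i + r)) n + a).
  { intros r'. rewrite (zsum_ext _ (fun i => (fun j => x (j + r')) (i + 1))).
    - rewrite (zsum_shift (fun j => x (j + r'))). replace (Z.of_nat n + r') with (r' + Z.of_nat n) by lia.
      rewrite Hx, Z.add_0_l. lia.
    - intros i. f_equal. lia. }
  induction r as [|r IH|r IH] using Z.peano_ind.
  - rewrite (zsum_ext _ x); [lia|]. intros i. f_equal. lia.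
  - specialize (Hs r). unfold Z.succ. lia.
  - specialize (Hs (Z.pred r)). replace (Z.pred r + 1) with r in Hs by lia. lia.
Qed.

(** * The long gaps *)

Definition left_ind (N nL i : Z) : Z := if i mod N <? nL then 1 else 0.

(* If s is inverse to r modulo N, this is the n in [0, N) with i = -1 + n r mod N. *)
Definition nu (N s i : Z) : Z := ((i + 1) * s) mod N.

(** Gap i joins the points i and i + 1. The image of gap -1, across 0, is the first long gap. After
    n1 steps the gap nL - 1, across the hole, is reached; it is the last long one, and its image is
    short again. *)
Definition large (N s n1 i : Z) : bool := (1 <=? nu N s i) && (nu N s i <=? n1).

Definition large_ind (N s n1 i : Z) : Z := if large N s n1 i then 1 else 0.

Lemma zsum_left_ind (N nL c h : Z) (n : nat) :
  0 <= nL <= N -> Z.of_nat n <= N ->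
  zsum (fun i => c + h * left_ind N nL i) n = Z.of_nat n * c + h * Z.min (Z.of_nat n) nL.
Proof.
  intros HL. induction n as [|n IH]; intros Hn; cbn [zsum].
  - rewrite Z.min_l by lia. lia.
  - rewrite IH by lia. unfold left_ind. rewrite Z.mod_small by lia.
    destruct (Z.ltb_spec (Z.of_nat n) nL).
    + rewrite !Z.min_l by lia. lia.
    + rewrite !Z.min_r by lia. lia.
Qed.

Lemma mod_succ (N i : Z) :
  0 < N -> (i + 1) mod N = if i mod N =? N - 1 then 0 else i mod N + 1.
Proof.
  intros HN. pose proof (Z.mod_pos_bound i N HN). pose proof (Z_div_mod_eq_full i N).
  destruct (Z.eqb_spec (i mod N) (N - 1)); symmetry.
  - apply (Z.mod_unique_pos _ _ (i / N + 1)); lia.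
  - apply (Z.mod_unique_pos _ _ (i / N)); lia.
Qed.

Lemma mod_of_divide (N x y : Z) : 0 <= y < N -> (N | x - y) -> x mod N = y.
Proof. intros Hy H. rewrite (mod_eq_of_divide _ _ _ H). now apply Z.mod_small. Qed.

Lemma divide_sub_mod (N x : Z) : (N | x - x mod N).
Proof.
  destruct (Z.eq_dec N 0) as [->|HN].
  - rewrite Zmod_0_r. exists 0. lia.
  - exists (x / N). pose proof (Z_div_mod_eq_full x N). lia.
Qed.

Lemma nu_shift (N r s i : Z) :
  0 < N -> (N | s * r - 1) -> nu N s (i + r) = (nu N s i + 1) mod N.
Proof.
  intros HN [k Hk]. unfold nu. rewrite Zplus_mod_idemp_l.
  apply mod_eq_of_divide. exists k. nia.
Qed.

Lemma nu_eq_iff (N r s i n : Z) :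
  0 < N -> (N | s * r - 1) -> 0 <= n < N ->
  nu N s i = n <-> (N | n * r - (i + 1)).
Proof.
  intros HN [k Hk] Hn. unfold nu. split.
  - intros <-. destruct (divide_sub_mod N ((i + 1) * s)) as [l Hl].
    exists ((i + 1) * k - l * r).
    replace (((i + 1) * s) mod N) with ((i + 1) * s - l * N) by lia.
    replace (((i + 1) * s - l * N) * r - (i + 1))
      with ((i + 1) * (s * r - 1) - l * r * N) by ring. rewrite Hk. ring.
  - intros [l Hl]. apply mod_of_divide; auto.
    exists (n * k - l * s).
    replace (i + 1) with (n * r - l * N) by lia.
    replace ((n * r - l * N) * s - n) with (n * (s * r - 1) - l * s * N) by ring.
    rewrite Hk. ring.
Qed.

(** Rotation by r advances [nu] by one, so [large_ind] changes only where [nu] leaves 0 or leaves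
    n1. Modulo N these are the indices -1 and nL - 1, precisely where [left_ind] jumps up and
    down. *)
Lemma large_shift (N r s nL n1 i : Z) :
  0 < nL < N -> (N | s * r - 1) -> 0 <= n1 < N -> (N | n1 * r - nL) ->
  large_ind N s n1 (i + r) - large_ind N s n1 i
  = left_ind N nL (i + 1) - left_ind N nL i.
Proof.
  intros HL Hs Hn1 Hd.
  assert (HN : 0 < N) by lia.
  pose proof (Z.mod_pos_bound i N HN) as Hi.
  assert (Hnu : 0 <= nu N s i < N) by now apply Z.mod_pos_bound.
  assert (H0 : nu N s i = 0 <-> i mod N = N - 1).
  { rewrite (nu_eq_iff N r) by (auto; lia). split.
    - intros [k Hk]. apply mod_of_divide; [lia|]. exists (- k - 1). lia.
    - intros E. destruct (divide_sub_mod N i) as [k Hk]. exists (- k - 1). lia. }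
  assert (H1 : nu N s i = n1 <-> i mod N = nL - 1).
  { rewrite (nu_eq_iff N r) by (auto; lia). destruct Hd as [d Hd]. split.
    - intros [k Hk]. apply mod_of_divide; [lia|]. exists (d - k). lia.
    - intros E. destruct (divide_sub_mod N i) as [k Hk]. exists (d - k). lia. }
  assert (n1 <> 0). { intros ->. destruct Hd as [d Hd]. assert (d <> 0) by lia.
    assert (- d * N = nL) by lia. assert (0 < - d) by nia. nia. }
  unfold large_ind, large, left_ind. rewrite (nu_shift N r) by auto.
  rewrite !mod_succ by auto. rewrite (Z.mod_small (nu N s i)) by auto.
  set (v := nu N s i) in *. set (j := i mod N) in *.
  destruct (Z.eqb_spec v (N - 1)), (Z.eqb_spec j (N - 1));
  repeat match goal with
    | |- context [Z.leb ?x ?y] => destruct (Z.leb_spec x y)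
    | |- context [Z.ltb ?x ?y] => destruct (Z.ltb_spec x y)
  end; simpl; try lia.
Qed.

(** The number 1 is an integer combination of r and N, so invariance under both translations gives
    invariance under 1. *)
Lemma translation_invariant_const (N r s : Z) (f : Z -> Z) :
  (N | s * r - 1) -> (forall i, f (i + r) = f i) -> (forall i, f (i + N) = f i) ->
  forall i, f (i + 1) = f i.
Proof.
  intros [k Hk] Hr HN.
  assert (Hmul : forall d, (forall i, f (i + d) = f i) -> forall m i, f (i + m * d) = f i).
  { intros d Hd m. induction m as [|m IH|m IH] using Z.peano_ind; intros i.
    - f_equal. lia.
    - replace (i + Z.succ m * d) with (i + m * d + d) by lia. now rewrite Hd.
    - rewrite <- (Hd (i + Z.pred m * d)).
      replace (i + Z.pred m * d + d) with (i + m * d) by lia. apply IH. }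
  intros i. rewrite <- (Hmul r Hr s i). rewrite <- (Hmul N HN k (i + 1)). f_equal. lia.
Qed.

Lemma const_of_succ (f : Z -> Z) : (forall i, f (i + 1) = f i) -> forall i, f i = f 0.
Proof.
  intros H i. induction i as [|i IH|i IH] using Z.peano_ind; auto.
  - rewrite <- IH. apply H.
  - rewrite <- IH. rewrite <- H. f_equal. lia.
Qed.

(** The bijection sends a long gap i to [nu N s i], with inverse n to (n r - 1) mod N. For k = nL -
    1 it turns the number of long gaps between left points into the cardinality in case 3). *)
Lemma card_is_large (N r s : Z) (n1 k : nat) :
  (N | s * r - 1) -> Z.of_nat n1 < N -> Z.of_nat k <= N ->
  card_is (fun n => (1 <= n <= n1)%nat /\ (Z.of_nat n * r - 1) mod N < Z.of_nat k)
          (count (large N s (Z.of_nat n1)) k).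
Proof.
  intros Hs Hn1 Hk.
  assert (HN : 0 < N) by lia.
  apply (card_is_bijection (fun i => (i < k)%nat /\ large N s (Z.of_nat n1) (Z.of_nat i) = true)
    _ (fun i => Z.to_nat (nu N s (Z.of_nat i)))); [| | |apply card_is_count].
  - intros i [Hi Hl]. unfold large in Hl. apply andb_prop in Hl.
    destruct Hl as [H1 H2]. apply Z.leb_le in H1, H2.
    split; [lia|]. rewrite Z2Nat.id by lia.
    assert (E : nu N s (Z.of_nat i) = nu N s (Z.of_nat i)) by auto.
    rewrite (nu_eq_iff N r) in E by (auto; lia).
    rewrite (mod_of_divide N _ (Z.of_nat i)); [lia|lia|].
    destruct E as [e E]. exists e. lia.
  - intros i j [Hi Hil] [Hj Hjl] E.
    unfold large in *. apply andb_prop in Hil, Hjl.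
    rewrite !Z.leb_le in Hil, Hjl.
    assert (E' : nu N s (Z.of_nat i) = nu N s (Z.of_nat j)) by lia.
    rewrite (nu_eq_iff N r) in E' by (auto; lia).
    assert (E'' : nu N s (Z.of_nat j) = nu N s (Z.of_nat j)) by auto.
    rewrite (nu_eq_iff N r) in E'' at 1 by (auto; lia).
    assert (Z.of_nat i = Z.of_nat j); [|lia].
    rewrite <- (Z.mod_small (Z.of_nat i) N) by lia.
    apply mod_of_divide; [lia|].
    destruct E' as [e E1]. destruct E'' as [e' E2]. exists (e' - e). lia.
  - intros n [Hn Hm]. pose proof (Z.mod_pos_bound (Z.of_nat n * r - 1) N HN) as Hb.
    set (i := (Z.of_nat n * r - 1) mod N) in *. exists (Z.to_nat i).
    rewrite Z2Nat.id by lia.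
    assert (E : nu N s i = Z.of_nat n).
    { apply (nu_eq_iff N r); auto; [lia|].
      destruct (divide_sub_mod N (Z.of_nat n * r - 1)) as [e E].
      exists e. fold i in E. lia. }
    unfold large. rewrite E. split; [|lia]. split; [lia|].
    apply andb_true_intro. split; apply Z.leb_le; lia.
Qed.

Lemma count_large_full (N s r : Z) (n1 k : nat) :
  (N | s * r - 1) -> Z.of_nat n1 < N -> Z.of_nat k = N ->
  count (large N s (Z.of_nat n1)) k = n1.
Proof.
  intros Hs Hn1 Hk. eapply card_is_unique; [apply (card_is_large N r s); auto; lia|].
  eapply card_is_ext; [|apply card_is_interval]. intros n. simpl.
  pose proof (Z.mod_pos_bound (Z.of_nat n * r - 1) N). split; [|tauto]. intros. split; auto. lia.
Qed.

(* Case 3 after rescaling, with g = B_d / N and X = r a. A cycle of N points has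
   d1 + d2 + 1 gaps of length g + h and d3 + d4 + 1 gaps of length g; of these,
   d1 long and d3 short ones separate the d1 + d3 + 1 points to the left of the hole. *)
Definition gap_pattern (a h c0 c1 : Z) (d1 d2 d3 d4 : nat) (g r delta : Z) : Prop :=
  let N := Z.of_nat (d1 + d2 + d3 + d4 + 2) in
  let n1 := Z.of_nat (d1 + d2 + 1) in
  let nL := Z.of_nat (d1 + d3 + 1) in
  0 < g /\ a = N * g + n1 * h /\ N * c1 + nL * h = r * a /\
  (N | n1 * r - nL) /\ Z.gcd r N = 1 /\ - g < delta < g /\
  c0 = Z.of_nat (d1 + 1) * h + nL * g + delta /\
  card_is (fun n => (1 <= n <= d1 + d2 + 1)%nat /\ 0 < (Z.of_nat n * r) mod N < nL) d1.

(** * From a cycle to the three cases *)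

Lemma mod_pred_iff (N x k : Z) :
  0 < N -> 0 < k <= N -> (x - 1) mod N < k - 1 <-> 0 < x mod N < k.
Proof.
  intros HN Hk. pose proof (mod_succ N (x - 1) HN) as E.
  pose proof (Z.mod_pos_bound (x - 1) N HN).
  replace (x - 1 + 1) with x in E by lia.
  destruct (Z.eqb_spec ((x - 1) mod N) (N - 1)); lia.
Qed.

Lemma large_last (N s n1 : Z) : large N s n1 (-1) = false.
Proof.
  unfold large, nu. replace ((-1 + 1) * s) with 0 by lia.
  now rewrite Zmod_0_l.
Qed.

Lemma large_at_hole (N r s nL n1 : Z) :
  (N | s * r - 1) -> 0 < n1 < N -> (N | n1 * r - nL) -> large N s n1 (nL - 1) = true.
Proof.
  intros Hs Hn1 Hd. unfold large. rewrite (proj2 (nu_eq_iff N r s (nL - 1) n1 ltac:(lia) Hs ltac:(lia))).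
  - apply andb_true_intro. split; apply Z.leb_le; lia.
  - now replace (nL - 1 + 1) with nL by lia.
Qed.

Lemma large_periodic (N s n1 i : Z) : large N s n1 (i + N) = large N s n1 i.
Proof.
  unfold large, nu. replace ((i + N + 1) * s) with ((i + 1) * s + s * N) by ring.
  now rewrite Z_mod_plus_full.
Qed.

Lemma cycle_cases (a h c0 c1 : Z) :
  0 < h -> h < c0 -> c0 < a ->
  has_cycle a (c0 - h) c0 (c1 + h) c1 ->
  c0 < Z.gcd a c1 \/ a + h - c0 < Z.gcd a (c1 + h) \/
  exists d1 d2 d3 d4 g r delta, gap_pattern a h c0 c1 d1 d2 d3 d4 g r delta.
Proof.
  intros Hh Hhc Hca Hcyc.
  destruct (cycle_rotation a h c0 c1) as
    (N & r & s & x & HN & Hs & Hx & HxN & Hstep & Hsafe & Hx0 & Hx1); auto; try lia.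
  clear Hcyc.
  assert (HxM : forall i, x i = x (i mod N) + (i / N) * a).
  { assert (HxM : forall m i, x (i + m * N) = x i + m * a).
    { intros m. induction m as [|m IH|m IH] using Z.peano_ind; intros i.
      - rewrite !Z.mul_0_l, !Z.add_0_r. easy.
      - replace (i + Z.succ m * N) with (i + m * N + N) by lia. rewrite HxN, IH. lia.
      - specialize (HxN (i + Z.pred m * N)).
        replace (i + Z.pred m * N + N) with (i + m * N) in HxN by lia.
        rewrite IH in HxN. lia. }
    intros i. rewrite <- HxM. f_equal. pose proof (Z_div_mod_eq_full i N). lia. }
  assert (HxN1 : x (N - 1) = x (-1) + a).
  { rewrite <- HxN. f_equal. lia. }
  assert (Hle : forall i j, i <= j -> x i <= x j).
  { intros i j Hij. destruct (Z.eq_dec i j) as [->|]; [lia|].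
    apply Z.lt_le_incl, increasing_lt; auto. lia. }
  assert (Hrange : forall i, 0 <= i < N -> 0 <= x i < a).
  { intros i Hi. pose proof (Hle 0 i). pose proof (Hle i (N - 1)). lia. }
  (* Here nL is the index of the first point at or beyond c0. Since index 0 is the first nonnegative
     point, the points 0 to nL - 1 are those left of the hole in one period. *)
  destruct (increasing_locate x) with (m := c0) as (nL & HnL & _).
  { intros n. specialize (Hx (n - 1)). replace (n - 1 + 1) with n in Hx by lia. lia. }
  assert (HL0 : 0 <= nL).
  { destruct (Z.lt_ge_cases nL 0); auto. pose proof (Hle nL (-1)). lia. }
  assert (HLN : nL <= N).
  { destruct (Z.lt_ge_cases N nL); auto. pose proof (Hle N (nL - 1)).
    pose proof (HxN 0) as E. rewrite Z.add_0_l in E. lia. }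
  assert (Hmod : forall i, 0 <= i < N -> x i mod a = x i).
  { intros i Hi. apply Z.mod_small. auto. }
  assert (Hleft : forall i, 0 <= i < N -> i < nL -> x i < c0 - h).
  { intros i Hi Hi'. pose proof (Hsafe i) as S. unfold safe in S. rewrite Hmod in S by auto.
    pose proof (Hle i (nL - 1)). lia. }
  assert (Hright : forall i, nL <= i -> c0 <= x i).
  { intros i Hi. pose proof (Hle nL i). lia. }
  assert (Hshift : forall i, x (i + r) = x i + c1 + h * left_ind N nL i).
  { intros i. rewrite <- Hstep. unfold step, left_ind.
    pose proof (Z.mod_pos_bound i N HN) as Hi.
    assert (x i mod a = x (i mod N)) as ->.
    { rewrite (HxM i), Z_mod_plus_full. auto. }
    destruct (Z.ltb_spec (i mod N) nL).
    - pose proof (Hleft (i mod N)). destruct (Z.ltb_spec (x (i mod N)) (c0 - h)); lia.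
    - pose proof (Hright (i mod N)). destruct (Z.ltb_spec (x (i mod N)) (c0 - h)); lia. }
  clear Hstep Hsafe.
  assert (Hsum : N * c1 + h * nL = r * a).
  { rewrite <- (zsum_translate x a r (Z.to_nat N)).
    - rewrite (zsum_ext _ (fun i => c1 + h * left_ind N nL i)).
      + rewrite zsum_left_ind by lia. rewrite Z2Nat.id by lia.
        now rewrite Z.min_r by lia.
      + intros i. rewrite Hshift. ring.
    - intros i. rewrite Z2Nat.id by lia. apply HxN. }
  set (g := x 0 - x (-1)).
  assert (Hg : 0 < g). { pose proof (Hle (-1) 0). pose proof (Hx (-1)). unfold g. simpl in *. lia. }
  (* If h e absorbs the changes of the gaps under the rotation, then gap minus h e is invariant
     under r and N, hence constant; its value is read off at index -1, where e vanishes. This is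
     applied to e = 0 for cycles on one side of the hole and to e = [large_ind] otherwise. *)
  assert (Hconst : forall e, (forall i, left_ind N nL (i + 1) - left_ind N nL i = e (i + r) - e i) ->
     (forall i, e (i + N) = e i) -> e (-1) = 0 -> forall i, x (i + 1) - x i = g + h * e i).
  { intros e He HeN He1.
    pose proof (const_of_succ (fun i => x (i + 1) - x i - h * e i)) as HC.
    assert (HC' : forall i, x (i + 1) - x i - h * e i = x (0 + 1) - x 0 - h * e 0).
    { apply HC. apply (translation_invariant_const N r s (fun i => x (i + 1) - x i - h * e i));
        auto; cbv beta.
      - intros i. replace (i + r + 1) with (i + 1 + r) by lia. rewrite !Hshift.
        specialize (He i). nia.
      - intros i. replace (i + N + 1) with (i + 1 + N) by lia. rewrite !HxN, HeN. lia. }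
    pose proof (HC' (-1)) as E. simpl in E.
    intros i. pose proof (HC' i) as E'. simpl in E'. unfold g. nia. }
  destruct (Z.eq_dec nL 0) as [EL|EL]; [|destruct (Z.eq_dec nL N) as [ER|ER]].
  1,2: assert (Hgap : forall i, x (i + 1) - x i = g) by
    (intros i; rewrite (Hconst (fun _ => 0)); [lia| |auto|auto];
     intros j; unfold left_ind; pose proof (Z.mod_pos_bound j N HN);
     pose proof (Z.mod_pos_bound (j + 1) N HN);
     destruct (Z.ltb_spec ((j + 1) mod N) nL), (Z.ltb_spec (j mod N) nL); lia).
  1,2: assert (Hlin : forall i, x i = x 0 + i * g) by
    (intros i; pose proof (const_of_succ (fun i => x i - i * g)) as HC;
     assert (x i - i * g = x 0 - 0 * g); [apply HC; intros j; specialize (Hgap j)|]; lia).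
  (* All points lie right of the hole: the gap g runs from below 0 to at least c0, and a = N g, c1 =
     r g. *)
  - left. subst nL.
    assert (Ga : (g | a)).
    { exists N. pose proof (HxN 0) as E. rewrite Hlin in E. lia. }
    assert (Gc : (g | c1)).
    { exists r. pose proof (Hshift 0) as E. rewrite Hlin in E.
      unfold left_ind in E. rewrite Zmod_0_l in E. simpl in E. lia. }
    pose proof (Z.gcd_greatest _ _ _ Ga Gc) as HG.
    apply Z.divide_pos_le in HG; [|pose proof (Z.gcd_nonneg a c1);
      pose proof (Z.gcd_eq_0_l a c1); lia].
    unfold g in HG. lia.
  (* All points lie left of the hole: the gap from x (N - 1) < c0 - h to x N >= a exceeds a + h -
     c0, and g divides a and c1 + h. *)
  - right; left. subst nL.
    assert (Ga : (g | a)).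
    { exists N. pose proof (HxN 0) as E. rewrite Hlin in E. lia. }
    assert (Gc : (g | c1 + h)).
    { exists r. pose proof (Hshift 0) as E. rewrite Hlin in E.
      unfold left_ind in E. rewrite Zmod_0_l in E.
      destruct (Z.ltb_spec 0 N); lia. }
    pose proof (Z.gcd_greatest _ _ _ Ga Gc) as HG.
    apply Z.divide_pos_le in HG; [|pose proof (Z.gcd_nonneg a (c1 + h));
      pose proof (Z.gcd_eq_0_l a (c1 + h)); lia].
    pose proof (Hleft (N - 1)). unfold g in HG. lia.
  - right; right.
    set (n1 := (nL * s) mod N).
    assert (Hn1 : 0 <= n1 < N) by now apply Z.mod_pos_bound.
    assert (Hd : (N | n1 * r - nL)).
    { destruct Hs as [k Hk]. destruct (divide_sub_mod N (nL * s)) as [l Hl]. fold n1 in Hl.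
      exists (nL * k - l * r). replace n1 with (nL * s - l * N) by lia.
      replace ((nL * s - l * N) * r - nL) with (nL * (s * r - 1) - l * r * N) by ring.
      rewrite Hk. ring. }
    assert (Hn1' : n1 <> 0).
    { intros E. rewrite E in Hd. assert (Hd' : (N | nL)).
      { destruct Hd as [d Hd]. exists (- d). lia. }
      apply Z.divide_pos_le in Hd'; lia. }
    assert (Hgap : forall i, x (i + 1) - x i = g + h * large_ind N s n1 i).
    { apply Hconst.
      - intros i. symmetry. apply large_shift; auto. lia.
      - intros i. unfold large_ind. now rewrite large_periodic.
      - unfold large_ind. now rewrite large_last. }
    set (cnt := count (large N s n1)).
    assert (Hform : forall n : nat, x (Z.of_nat n) = x 0 + Z.of_nat n * g + h * Z.of_nat (cnt n)).
    { induction n as [|n IH]; [simpl; lia|].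
      specialize (Hgap (Z.of_nat n)). rewrite Nat2Z.inj_succ. unfold Z.succ.
      unfold cnt in *. cbn [count]. unfold large_ind in Hgap.
      destruct (large N s n1 (Z.of_nat n)); lia. }
    pose proof (card_is_large N r s (Z.to_nat n1) (Z.to_nat (nL - 1)) Hs ltac:(lia) ltac:(lia)) as HE.
    pose proof (count_large_full N s r (Z.to_nat n1) (Z.to_nat N) Hs ltac:(lia) ltac:(lia)) as HF.
    rewrite (Z2Nat.id n1), (Z2Nat.id (nL - 1)) in HE by lia.
    rewrite (Z2Nat.id n1) in HF by lia. fold cnt in HE, HF.
    assert (Hc1 : cnt (Z.to_nat nL) = (cnt (Z.to_nat (nL - 1)) + 1)%nat).
    { replace (Z.to_nat nL) with (S (Z.to_nat (nL - 1))) by lia. unfold cnt. cbn [count].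
      rewrite Z2Nat.id by lia. now rewrite (large_at_hole N r) by (auto; lia). }
    assert (Hc2 : cnt (Z.to_nat N) = cnt (Z.to_nat (N - 1))).
    { replace (Z.to_nat N) with (S (Z.to_nat (N - 1))) by lia. unfold cnt. cbn [count].
      rewrite Z2Nat.id by lia. replace (N - 1) with (-1 + N) by lia.
      rewrite large_periodic, large_last. lia. }
    pose proof (count_lipschitz (large N s n1) 0 (Z.to_nat (nL - 1)) ltac:(lia)) as L1.
    pose proof (count_lipschitz (large N s n1) (Z.to_nat nL) (Z.to_nat (N - 1)) ltac:(lia)) as L2.
    fold cnt in L1, L2. change (cnt 0%nat) with 0%nat in L1.
    (* Among the left points there are d1 long and d3 short gaps, followed by the long gap nL - 1
       across the hole; then come d2 long and d4 short gaps among the right points, and the short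
       gap N - 1 across a. The two special gaps account for the 2 in N. *)
    set (d1 := cnt (Z.to_nat (nL - 1))) in *.
    set (d2 := (cnt (Z.to_nat (N - 1)) - cnt (Z.to_nat nL))%nat).
    set (d3 := (Z.to_nat (nL - 1) - d1)%nat).
    set (d4 := (Z.to_nat (N - 1) - Z.to_nat nL - d2)%nat).
    assert (EN : Z.of_nat (d1 + d2 + d3 + d4 + 2) = N) by lia.
    assert (En1 : Z.of_nat (d1 + d2 + 1) = n1) by lia.
    assert (EnL : Z.of_nat (d1 + d3 + 1) = nL) by lia.
    assert (XN : x N = x 0 + N * g + h * n1).
    { specialize (Hform (Z.to_nat N)). rewrite Z2Nat.id in Hform by lia. lia. }
    assert (XL : x nL = x 0 + nL * g + h * Z.of_nat (d1 + 1)).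
    { specialize (Hform (Z.to_nat nL)). rewrite Z2Nat.id in Hform by lia. lia. }
    assert (XL1 : x (nL - 1) = x 0 + (nL - 1) * g + h * Z.of_nat d1).
    { specialize (Hform (Z.to_nat (nL - 1))). rewrite Z2Nat.id in Hform by lia. exact Hform. }
    (* The last witness equals c0 + x 0 - x nL. From x nL >= c0 it is at most x 0 < g; from x (nL -
       1) < c0 - h it exceeds x 0 - g >= - g. *)
    exists d1, d2, d3, d4, g, r, (c0 - (Z.of_nat (d1 + 1) * h + nL * g)).
    unfold gap_pattern. rewrite EN, En1, EnL.
    split; [auto|]. split; [|split; [lia|split; [auto|split; [|split; [|split; [lia|]]]]]].
    + pose proof (HxN 0) as E. rewrite Z.add_0_l in E. lia.
    + apply Z.bezout_1_gcd. destruct Hs as [k Hk]. exists s, (- k). lia.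
    + pose proof (Hleft (nL - 1)). unfold g in *. lia.
    + eapply card_is_ext; [|exact HE]. intros n. cbv beta.
      rewrite mod_pred_iff by lia.
      split; intros [H1 H2]; split; auto; lia.
Qed.

(** * From the three cases to a cycle *)

Lemma cycle_of_gap_pattern (a h c0 c1 : Z) (d1 d2 d3 d4 : nat) (g r delta : Z) :
  0 < h -> gap_pattern a h c0 c1 d1 d2 d3 d4 g r delta ->
  has_cycle a (c0 - h) c0 (c1 + h) c1.
Proof.
  intros Hh. unfold gap_pattern.
  set (N := Z.of_nat (d1 + d2 + d3 + d4 + 2)). set (n1 := Z.of_nat (d1 + d2 + 1)).
  set (nL := Z.of_nat (d1 + d3 + 1)).
  intros (Hg & Ha & HX & Hd & Hgcd & Hdelta & Hc0 & HE).
  assert (HN : 0 < N) by lia.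
  assert (Hs : exists s, (N | s * r - 1)).
  { destruct (Z.gcd_bezout r N 1 Hgcd) as (s & k & E). exists s, (- k). lia. }
  destruct Hs as [s Hs].
  set (cnt := count (large N s n1)).
  assert (HcN : cnt (Z.to_nat N) = (d1 + d2 + 1)%nat).
  { unfold cnt, n1. apply (count_large_full N s r); auto; lia. }
  assert (Hc1 : cnt (Z.to_nat (nL - 1)) = d1).
  { eapply card_is_unique; [|exact HE].
    eapply card_is_ext; [|apply (card_is_large N r s (d1 + d2 + 1)); auto; lia].
    intros n. cbv beta. rewrite Z2Nat.id by lia. rewrite mod_pred_iff by lia. reflexivity. }
  assert (Hc2 : cnt (Z.to_nat nL) = (d1 + 1)%nat).
  { replace (Z.to_nat nL) with (S (Z.to_nat (nL - 1))) by lia. unfold cnt in *. cbn [count].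
    rewrite Z2Nat.id by lia. rewrite (large_at_hole N r) by (auto; lia). lia. }
  (* The start must satisfy y >= 0 and y >= delta, for x 0 >= 0 and x nL >= c0, and also y < g and y
     < g + delta, for x (N - 1) < a and x (nL - 1) < c0 - h. The least candidate works because
     |delta| < g. *)
  set (y := Z.max 0 delta).
  set (x := fun i => y + g * i + h * (Z.of_nat (cnt (Z.to_nat (i mod N))) + n1 * (i / N))).
  assert (HxN : forall i, x (i + N) = x i + a).
  { intros i. unfold x. replace (i + N) with (i + 1 * N) by lia.
    rewrite Z_mod_plus_full, Z_div_plus_full by lia. rewrite Ha. ring. }
  assert (Hlm : forall i, large N s n1 (i mod N) = large N s n1 i).
  { intros i. unfold large, nu.
    replace (((i mod N + 1) * s) mod N) with (((i + 1) * s) mod N); auto.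
    apply mod_eq_of_divide. destruct (divide_sub_mod N i) as [k Hk]. exists (k * s). nia. }
  assert (Hgap : forall i, x (i + 1) - x i = g + h * large_ind N s n1 i).
  { intros i. unfold x. rewrite mod_succ by auto.
    pose proof (Z.mod_pos_bound i N HN). pose proof (Z_div_mod_eq_full i N).
    assert (HS : Z.of_nat (cnt (S (Z.to_nat (i mod N)))) =
                 Z.of_nat (cnt (Z.to_nat (i mod N))) + large_ind N s n1 i).
    { unfold cnt, large_ind. cbn [count]. rewrite Z2Nat.id by lia. rewrite Hlm.
      destruct (large N s n1 i); lia. }
    destruct (Z.eqb_spec (i mod N) (N - 1)) as [E|E].
    - assert ((i + 1) / N = i / N + 1) as ->.
      { symmetry. apply (Z.div_unique_pos _ _ _ 0); lia. }
      replace (S (Z.to_nat (i mod N))) with (Z.to_nat N) in HS by lia.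
      rewrite HcN in HS. change (Z.of_nat (cnt (Z.to_nat 0))) with 0. fold n1 in HS. nia.
    - assert ((i + 1) / N = i / N) as ->.
      { symmetry. apply (Z.div_unique_pos _ _ _ (i mod N + 1)); lia. }
      replace (Z.to_nat (i mod N + 1)) with (S (Z.to_nat (i mod N))) by lia.
      rewrite HS. ring. }
  (* By [large_shift], the displacement x (i + r) - x i varies with i exactly as h [left_ind] does.
     Its sum over a period is r a = N C + nL h, and comparison with N c1 + nL h = r a then gives C =
     c1. *)
  assert (HD : exists C, forall i, x (i + r) - x i = C + h * left_ind N nL i).
  { pose proof (const_of_succ (fun i => x (i + r) - x i - h * left_ind N nL i)) as HC.
    exists (x (0 + r) - x 0 - h * left_ind N nL 0). intros i.
    rewrite <- (HC) with (i := i); [ring|]. intros j.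
    pose proof (Hgap (j + r)) as G1. pose proof (Hgap j) as G2.
    pose proof (large_shift N r s nL n1 j ltac:(lia) Hs ltac:(lia) Hd) as G3.
    replace (j + 1 + r) with (j + r + 1) by lia. nia. }
  destruct HD as [C HD].
  assert (HC : C = c1).
  { pose proof (zsum_translate x a r (Z.to_nat N)) as E.
    rewrite Z2Nat.id in E by lia. specialize (E HxN).
    rewrite (zsum_ext _ (fun i => C + h * left_ind N nL i)) in E by auto.
    rewrite zsum_left_ind in E by lia. rewrite Z2Nat.id, Z.min_r in E by lia. nia. }
  subst C.
  assert (Hinc : forall i, x i < x (i + 1)).
  { intros i. specialize (Hgap i). unfold large_ind in Hgap. destruct (large N s n1 i); lia. }
  assert (Hle : forall i j, i <= j -> x i <= x j).
  { intros i j Hij. destruct (Z.eq_dec i j) as [->|]; [lia|].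
    apply Z.lt_le_incl, increasing_lt; auto. lia. }
  assert (Hsmall : forall i, 0 <= i < N -> x i = y + g * i + h * Z.of_nat (cnt (Z.to_nat i))).
  { intros i Hi. unfold x. rewrite Z.mod_small, Z.div_small by lia. ring. }
  assert (X0 : x 0 = y). { rewrite Hsmall by lia. change (cnt (Z.to_nat 0)) with 0%nat. lia. }
  assert (XL1 : x (nL - 1) < c0 - h). { rewrite Hsmall, Hc1 by lia. unfold y. nia. }
  assert (XL : c0 <= x nL). { rewrite Hsmall, Hc2 by lia. unfold y. nia. }
  assert (XN : x (N - 1) < a).
  { specialize (Hgap (-1)). unfold large_ind in Hgap. rewrite large_last in Hgap.
    simpl in Hgap. specialize (HxN (-1)). replace (-1 + N) with (N - 1) in HxN by lia.
    unfold y in *. lia. }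
  assert (Hmod : forall i, x i mod a = x (i mod N)).
  { intros i. pose proof (Z.mod_pos_bound i N HN) as Hi.
    pose proof (Hle 0 (i mod N)). pose proof (Hle (i mod N) (N - 1)).
    symmetry. apply (Z.mod_unique_pos _ _ (i / N)); [unfold y in *; lia|].
    unfold x. rewrite Zmod_mod, (Z.div_small (i mod N)) by lia.
    pose proof (Z_div_mod_eq_full i N) as E. rewrite Ha. nia. }
  assert (Hcase : forall i, (left_ind N nL i = 1 /\ x i mod a < c0 - h) \/
                            (left_ind N nL i = 0 /\ c0 <= x i mod a)).
  { intros i. rewrite Hmod. unfold left_ind. pose proof (Z.mod_pos_bound i N HN).
    destruct (Z.ltb_spec (i mod N) nL).
    - left. pose proof (Hle (i mod N) (nL - 1)). lia.
    - right. pose proof (Hle nL (i mod N)). lia. }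
  assert (Horb : forall n : nat, orbit a (c0 - h) (c1 + h) c1 n (x 0) = x (Z.of_nat n * r)).
  { induction n as [|n IH]; [reflexivity|].
    change (orbit a (c0 - h) (c1 + h) c1 (S n) (x 0))
      with (step a (c0 - h) (c1 + h) c1 (orbit a (c0 - h) (c1 + h) c1 n (x 0))).
    rewrite IH. replace (Z.of_nat (S n) * r) with (Z.of_nat n * r + r) by lia.
    pose proof (HD (Z.of_nat n * r)) as E. pose proof (Hcase (Z.of_nat n * r)) as Hc.
    unfold step. destruct (Z.ltb_spec (x (Z.of_nat n * r) mod a) (c0 - h)); lia. }
  exists (x 0), (Z.to_nat N). split; [lia|split].
  - rewrite Horb, Z2Nat.id by lia. apply divide_of_mod_eq. rewrite !Hmod. f_equal.
    rewrite Z.mul_comm, Z_mod_mult, Zmod_0_l. reflexivity.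
  - intros i. rewrite Horb. specialize (Hcase (Z.of_nat i * r)). unfold safe. lia.
Qed.

(** Numbers congruent to -1 modulo g = gcd(a, c1) have residues modulo a of at least g - 1 >= c0.
    They stay right of the hole, where the map is translation by c1, and a steps close the cycle. *)
Lemma cycle_of_gcd_right (a h c0 c1 : Z) :
  0 < a -> 0 <= h -> c0 < Z.gcd a c1 -> has_cycle a (c0 - h) c0 (c1 + h) c1.
Proof.
  intros Ha Hh Hg. set (g := Z.gcd a c1) in *.
  assert (Hgp : 0 < g).
  { pose proof (Z.gcd_nonneg a c1). pose proof (Z.gcd_eq_0_l a c1). unfold g. lia. }
  assert (Hres : forall y, (g | y - (g - 1)) -> c0 <= y mod a).
  { intros y Hy. destruct (Z.gcd_divide_l a c1) as [k Hk]. fold g in Hk.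
    pose proof (Z.mod_pos_bound y a Ha). pose proof (Z_div_mod_eq_full y a).
    destruct Hy as [l Hl].
    assert (E : y mod a = (l + 1 - k * (y / a)) * g - 1).
    { replace y with (a * (y / a) + y mod a) in Hl at 1 by lia. rewrite Hk in Hl at 1.
      replace (y mod a) with (l * g + (g - 1) - k * g * (y / a)) by lia. ring. }
    set (m := l + 1 - k * (y / a)) in *. assert (1 <= m) by nia. nia. }
  assert (Horb : forall n, orbit a (c0 - h) (c1 + h) c1 n (g - 1) = g - 1 + Z.of_nat n * c1).
  { induction n as [|n IH]; [simpl; lia|].
    change (orbit a (c0 - h) (c1 + h) c1 (S n) (g - 1))
      with (step a (c0 - h) (c1 + h) c1 (orbit a (c0 - h) (c1 + h) c1 n (g - 1))).
    rewrite IH. unfold step.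
    assert (c0 <= (g - 1 + Z.of_nat n * c1) mod a).
    { apply Hres. replace (g - 1 + Z.of_nat n * c1 - (g - 1)) with (Z.of_nat n * c1) by lia.
      apply Z.divide_mul_r, Z.gcd_divide_r. }
    destruct (Z.ltb_spec ((g - 1 + Z.of_nat n * c1) mod a) (c0 - h)); lia. }
  exists (g - 1), (Z.to_nat a). split; [lia|split].
  - rewrite Horb. exists c1. lia.
  - intros i. right. apply Hres. rewrite Horb.
    replace (g - 1 + Z.of_nat i * c1 - (g - 1)) with (Z.of_nat i * c1) by lia.
    apply Z.divide_mul_r, Z.gcd_divide_r.
Qed.

(** Multiples of g = gcd(a, c1 + h) have residues modulo a of at most a - g < c0 - h. They stay left
    of the hole, where the map is translation by c1 + h. *)
Lemma cycle_of_gcd_left (a h c0 c1 : Z) :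
  0 < a -> a + h - c0 < Z.gcd a (c1 + h) -> has_cycle a (c0 - h) c0 (c1 + h) c1.
Proof.
  intros Ha Hg. set (g := Z.gcd a (c1 + h)) in *.
  assert (Hgp : 0 < g).
  { pose proof (Z.gcd_nonneg a (c1 + h)). pose proof (Z.gcd_eq_0_l a (c1 + h)). unfold g. lia. }
  assert (Hres : forall n : nat, (Z.of_nat n * (c1 + h)) mod a < c0 - h).
  { intros n. destruct (Z.gcd_divide_l a (c1 + h)) as [k Hk].
    destruct (Z.gcd_divide_r a (c1 + h)) as [l Hl]. fold g in Hk, Hl.
    set (y := Z.of_nat n * (c1 + h)).
    pose proof (Z.mod_pos_bound y a Ha). pose proof (Z_div_mod_eq_full y a).
    assert (E : y mod a = (Z.of_nat n * l - k * (y / a)) * g).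
    { replace (y mod a) with (y - a * (y / a)) by lia. unfold y at 1. rewrite Hl, Hk at 1. ring. }
    set (m := Z.of_nat n * l - k * (y / a)) in *. assert (m + 1 <= k) by nia. nia. }
  assert (Horb : forall n, orbit a (c0 - h) (c1 + h) c1 n 0 = Z.of_nat n * (c1 + h)).
  { induction n as [|n IH]; [simpl; lia|].
    change (orbit a (c0 - h) (c1 + h) c1 (S n) 0)
      with (step a (c0 - h) (c1 + h) c1 (orbit a (c0 - h) (c1 + h) c1 n 0)).
    rewrite IH. unfold step. specialize (Hres n).
    destruct (Z.ltb_spec ((Z.of_nat n * (c1 + h)) mod a) (c0 - h)); lia. }
  exists 0, (Z.to_nat a). split; [lia|split].
  - rewrite Horb. exists (c1 + h). lia.
  - intros i. left. rewrite Horb. apply Hres.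
Qed.

(* Rescaling from the reals to the integers *)
Local Close Scope Z_scope.
Local Open Scope R_scope.

Lemma floorZ_div (m n : Z) : (0 < n)%Z -> floorZ (IZR m / IZR n) = (m / n)%Z.
Proof.
  intros Hn. unfold floorZ. symmetry. apply Int_part_spec.
  assert (Hn' : 0 < IZR n) by now apply IZR_lt.
  pose proof (Z.mod_pos_bound m n Hn) as [H1 H2]. apply IZR_le in H1. apply IZR_lt in H2.
  pose proof (f_equal IZR (Z_div_mod_eq_full m n)) as E. rewrite plus_IZR, mult_IZR in E.
  assert (E' : IZR m / IZR n = IZR (m / n) + IZR (m mod n) / IZR n)
    by (rewrite E at 1; field; lra).
  assert (0 <= IZR (m mod n) / IZR n) by (apply Rle_mult_inv_pos; lra).
  assert (IZR (m mod n) / IZR n < 1) by (apply Rmult_lt_reg_r with (IZR n); [lra|];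
    unfold Rdiv; rewrite Rmult_assoc, Rinv_l; lra).
  lra.
Qed.

Lemma chi_eq_1 (c s : R) : chi c s = 1 <-> 0 <= s < c.
Proof. unfold chi. destruct (Rle_dec 0 s), (Rlt_dec s c); lra. Qed.

(** The window has its ends on the grid u Z, so t enters only through the integer part of t / u;
    this replaces a real t by an integer. *)
Lemma chi_scaled (u t : R) (k z : Z) :
  0 < u -> chi (IZR k * u) (t + IZR z * u) = 1 <-> (0 <= Int_part (t / u) + z < k)%Z.
Proof.
  intros Hu. rewrite chi_eq_1.
  destruct (base_Int_part (t / u)) as [H1 H2]. set (T := Int_part (t / u)) in *.
  assert (Et : t = (t / u) * u) by (field; lra). set (tau := t / u) in *. rewrite Et.
  replace (tau * u + IZR z * u) with ((tau + IZR z) * u) by ring.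
  split.
  - intros [H3 H4]. apply Rmult_lt_reg_r in H4; auto.
    assert (0 <= tau + IZR z) by (apply Rmult_le_reg_r with u; lra).
    split.
    + apply Z.lt_succ_r. unfold Z.succ. apply lt_IZR. rewrite !plus_IZR. lra.
    + apply lt_IZR. rewrite plus_IZR. lra.
  - intros [H3 H4].
    assert (H5 : (T + z + 1 <= k)%Z) by lia. apply IZR_le in H3, H5.
    rewrite !plus_IZR in *. split.
    + apply Rmult_le_pos; lra.
    + apply Rmult_lt_compat_r; lra.
Qed.

Lemma in_S_scaled (u : R) (p q k : Z) :
  0 < u ->
  (exists t, in_S (IZR p * u) (IZR q * u) (IZR k * u) t) <->
  (exists t x, tiling p q k t x).
Proof.
  intros Hu.
  assert (Hiff : forall t m j,
    chi (IZR k * u) (t - IZR m * (IZR p * u) + IZR j * (IZR q * u)) = 1 <->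
    (0 <= Int_part (t / u) - m * p + j * q < k)%Z).
  { intros t m j.
    replace (t - IZR m * (IZR p * u) + IZR j * (IZR q * u))
      with (t + IZR (- m * p + j * q) * u) by (rewrite plus_IZR, !mult_IZR, opp_IZR; ring).
    rewrite chi_scaled by auto. lia. }
  split.
  - intros (t & x & Hx & Hrow). exists (Int_part (t / u)), x. split; auto.
    intros m. destruct (Hrow m) as (j & [H1 H2] & Huniq). exists j. split.
    + split; auto. now apply Hiff.
    + intros j' [H3 H4]. apply Huniq. split; auto. now apply Hiff.
  - intros (t & x & Hx & Hrow). exists (IZR t * u), x. split; auto.
    assert (Et : Int_part (IZR t * u / u) = t).
    { replace (IZR t * u / u) with (IZR t) by (field; lra). symmetry.
      apply Int_part_spec. lra. }
    intros m. destruct (Hrow m) as (j & [H1 H2] & Huniq). exists j. split.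
    + split; auto. apply Hiff. now rewrite Et.
    + intros j' [H3 H4]. apply Huniq. split; auto. apply Hiff in H4. now rewrite Et in H4.
Qed.

Lemma in_mult_scaled (u : R) (x d : Z) :
  u <> 0 -> in_mult (IZR x * u) (IZR d * u) <-> (d | x)%Z.
Proof.
  intros Hu. split; intros [k E]; exists k.
  - apply eq_IZR. rewrite mult_IZR. apply Rmult_eq_reg_r with u; auto. lra.
  - rewrite E, mult_IZR. ring.
Qed.

Lemma is_lat_gcd_scaled (u : R) (q x y : Z) (d : R) :
  0 < u -> (0 < q)%Z -> (0 < x)%Z ->
  is_lat_gcd (IZR q * u) q (IZR x * u) (IZR y * u) d <-> d = IZR (Z.gcd x y) * u.
Proof.
  intros Hu Hq Hx.
  assert (Hq' : 0 < IZR q) by now apply IZR_lt.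
  assert (Hg : (0 < Z.gcd x y)%Z).
  { pose proof (Z.gcd_nonneg x y). pose proof (Z.gcd_eq_0_l x y). lia. }
  unfold is_lat_gcd. replace (IZR q * u / IZR q) with u by (field; lra).
  assert (Hlat : forall e, 0 < e -> in_mult e u -> in_mult (IZR x * u) e ->
            in_mult (IZR y * u) e -> e <= IZR (Z.gcd x y) * u).
  { intros e He [k ->] H1 H2.
    apply in_mult_scaled in H1; [|lra]. apply in_mult_scaled in H2; [|lra].
    apply Rmult_le_compat_r; [lra|]. apply IZR_le.
    apply Z.divide_pos_le; auto. now apply Z.gcd_greatest. }
  assert (Hself : 0 < IZR (Z.gcd x y) * u /\ in_mult (IZR (Z.gcd x y) * u) u /\
     in_mult (IZR x * u) (IZR (Z.gcd x y) * u) /\ in_mult (IZR y * u) (IZR (Z.gcd x y) * u)).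
  { split; [|split; [|split]].
    - apply Rmult_lt_0_compat; auto. now apply IZR_lt.
    - now exists (Z.gcd x y).
    - apply in_mult_scaled; [lra|]. apply Z.gcd_divide_l.
    - apply in_mult_scaled; [lra|]. apply Z.gcd_divide_r. }
  split.
  - intros (H1 & H2 & H3 & H4 & H5). apply Rle_antisym; auto.
    apply H5; tauto.
  - intros ->. tauto.
Qed.

Lemma gcd_condition_scaled (u : R) (q x y z : Z) :
  0 < u -> (0 < q)%Z -> (0 < x)%Z ->
  (exists g, is_lat_gcd (IZR q * u) q (IZR x * u) (IZR y * u) g /\ IZR z * u < g) <->
  (z < Z.gcd x y)%Z.
Proof.
  intros Hu Hq Hx. split.
  - intros (g & Hg & Hz). apply is_lat_gcd_scaled in Hg; auto. subst g.
    apply Rmult_lt_reg_r in Hz; auto. now apply lt_IZR.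
  - intros Hz. exists (IZR (Z.gcd x y) * u). split.
    + now apply is_lat_gcd_scaled.
    + apply Rmult_lt_compat_r; auto. now apply IZR_lt.
Qed.

(** Membership of B_d in N (b/q) Z supplies g, and membership of X in a Z supplies r. Dividing by u
    = b/q, or by a, turns the remaining clauses into statements about integers. *)
Lemma gap_pattern_scaled (u : R) (p q z0 z1 : Z) (d1 d2 d3 d4 : nat) :
  0 < u -> (0 < p)%Z -> (p < q)%Z -> (0 < z1)%Z ->
  let a := IZR p * u in let b := IZR q * u in
  let c0 := IZR z0 * u in let c1 := IZR z1 * u in
  let N := INR (d1 + d2 + d3 + d4 + 2) in
  let Bd := a - INR (d1 + d2 + 1) * (b - a) in
  let X := N * c1 + INR (d1 + d3 + 1) * (b - a) in
  (0 < Bd /\ in_mult Bd (N * (b / IZR q)) /\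
   in_mult X a /\
   in_mult (INR (d1 + d2 + 1) * X - INR (d1 + d3 + 1) * a) (N * a) /\
   (exists delta : R,
      c0 = INR (d1 + 1) * (b - a) + INR (d1 + d3 + 1) * Bd / N + delta /\
      - Rmin (Bd / N) (a - c0) < delta /\
      delta < Rmin (Bd / N) (c0 + a - b)) /\
   is_lat_gcd b q X (N * a) a /\
   card_is (fun n : nat =>
              (1 <= n <= d1 + d2 + 1)%nat /\
              exists r : R, exists m : Z,
                0 < r /\ r < INR (d1 + d3 + 1) * a /\
                INR n * X = r + IZR m * (N * a)) d1) <->
  exists g r delta, gap_pattern p (q - p) z0 z1 d1 d2 d3 d4 g r delta.
Proof.
  intros Hu Hp Hpq Hz1 a b c0 c1 N Bd X.
  assert (Hq' : 0 < IZR q) by (apply IZR_lt; lia).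
  assert (Ha : 0 < a) by (apply Rmult_lt_0_compat; auto; now apply IZR_lt).
  set (ZN := Z.of_nat (d1 + d2 + d3 + d4 + 2)).
  set (n1 := Z.of_nat (d1 + d2 + 1)). set (nL := Z.of_nat (d1 + d3 + 1)).
  assert (EN : N = IZR ZN) by apply INR_IZR_INZ.
  assert (En1 : INR (d1 + d2 + 1) = IZR n1) by apply INR_IZR_INZ.
  assert (EnL : INR (d1 + d3 + 1) = IZR nL) by apply INR_IZR_INZ.
  assert (Ed1 : INR (d1 + 1) = IZR (Z.of_nat (d1 + 1))) by apply INR_IZR_INZ.
  assert (HZN : (0 < ZN)%Z) by lia.
  assert (HN : 0 < N) by (rewrite EN; now apply IZR_lt).
  assert (Ebq : b / IZR q = u) by (unfold b; field; lra).
  assert (EBd : Bd = IZR (p - n1 * (q - p)) * u).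
  { unfold Bd, a, b. rewrite En1, !minus_IZR, !mult_IZR, !minus_IZR. ring. }
  set (zX := (ZN * z1 + nL * (q - p))%Z).
  assert (EX : X = IZR zX * u).
  { unfold X, zX, c1, a, b. rewrite EN, EnL, plus_IZR, !mult_IZR, !minus_IZR. ring. }
  assert (HzX : (0 < zX)%Z) by (unfold zX; nia).
  assert (ENa : N * a = IZR (ZN * p) * u).
  { unfold a. rewrite EN, mult_IZR. ring. }
  assert (HnLN : (nL < ZN)%Z) by lia.
  assert (Hcard : forall r, zX = (r * p)%Z -> forall n : nat,
    ((1 <= n <= d1 + d2 + 1)%nat /\ (exists (s : R) (m : Z), 0 < s /\
       s < INR (d1 + d3 + 1) * a /\ INR n * X = s + IZR m * (N * a))) <->
    ((1 <= n <= d1 + d2 + 1)%nat /\ (0 < (Z.of_nat n * r) mod ZN < nL)%Z)).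
  { intros r Hr n. rewrite EnL, EN, EX, INR_IZR_INZ, Hr, mult_IZR. fold a.
    replace (IZR r * IZR p * u) with (IZR r * a) by (unfold a; ring).
    apply and_iff_compat_l. split.
    - intros (s & m & H1 & H2 & H3).
      assert (Es : s = IZR (Z.of_nat n * r - m * ZN) * a).
      { rewrite minus_IZR, !mult_IZR. lra. }
      rewrite Es in H1, H2. apply Rmult_lt_reg_r in H2; auto. apply lt_IZR in H2.
      assert (H4 : (0 < Z.of_nat n * r - m * ZN)%Z).
      { apply lt_IZR. apply Rmult_lt_reg_r with a; lra. }
      rewrite (mod_of_divide ZN _ (Z.of_nat n * r - m * ZN)); [lia|lia|exists m; lia].
    - intros [H1 H2].
      exists (IZR ((Z.of_nat n * r) mod ZN) * a), ((Z.of_nat n * r) / ZN)%Z.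
      split; [|split].
      + apply Rmult_lt_0_compat; auto. now apply IZR_lt.
      + apply Rmult_lt_compat_r; auto. now apply IZR_lt.
      + rewrite <- !Rmult_assoc, <- Rmult_plus_distr_r. f_equal.
        rewrite <- !mult_IZR, <- plus_IZR. f_equal.
        pose proof (Z_div_mod_eq_full (Z.of_nat n * r) ZN). lia. }
  assert (Hgcd : forall r, zX = (r * p)%Z ->
            (is_lat_gcd b q X (N * a) a <-> Z.gcd r ZN = 1%Z)).
  { intros r Hr. rewrite EX, ENa. unfold b. rewrite is_lat_gcd_scaled by (auto; lia).
    rewrite Hr, Z.gcd_mul_mono_r, (Z.abs_eq p) by lia. unfold a. split.
    - intros E. apply Rmult_eq_reg_r in E; [|lra]. apply eq_IZR in E. nia.
    - intros ->. now rewrite Z.mul_1_l. }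
  assert (Hdiv : forall r, zX = (r * p)%Z ->
    (in_mult (INR (d1 + d2 + 1) * X - INR (d1 + d3 + 1) * a) (N * a) <-> (ZN | n1 * r - nL)%Z)).
  { intros r Hr.
    replace (INR (d1 + d2 + 1) * X - INR (d1 + d3 + 1) * a) with (IZR (n1 * r - nL) * a).
    - rewrite EN. apply in_mult_scaled. lra.
    - rewrite En1, EnL, EX, Hr, minus_IZR, !mult_IZR. unfold a. ring. }
  unfold gap_pattern. fold ZN n1 nL. split.
  - intros (H1 & H2 & H3 & H4 & (delta & H5 & H6 & H7) & H8 & H9).
    destruct H2 as [g Hg]. rewrite Ebq in Hg.
    assert (Eg : (p - n1 * (q - p) = g * ZN)%Z).
    { apply eq_IZR. apply Rmult_eq_reg_r with u; [|lra].
      rewrite <- EBd, Hg, EN, mult_IZR. ring. }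
    assert (HgN : Bd / N = IZR g * u) by (rewrite Hg; field; lra).
    rewrite EX in H3. unfold a in H3. apply in_mult_scaled in H3; [|lra].
    destruct H3 as [r Hr].
    set (dz := (z0 - (Z.of_nat (d1 + 1) * (q - p) + nL * g))%Z).
    assert (Edelta : delta = IZR dz * u).
    { unfold dz. rewrite minus_IZR, plus_IZR, !mult_IZR, minus_IZR.
      unfold Rdiv in H5. rewrite Rmult_assoc in H5. fold (Bd / N) in H5.
      rewrite HgN, EnL, Ed1 in H5. unfold c0, b, a in H5. lra. }
    exists g, r, dz.
    assert (H6' : - (IZR g * u) < delta).
    { pose proof (Rmin_l (Bd / N) (a - c0)). lra. }
    assert (H7' : delta < IZR g * u).
    { pose proof (Rmin_l (Bd / N) (c0 + a - b)). lra. }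
    split; [|split; [lia|split; [lia|split; [|split; [|split; [|split; [lia|]]]]]]].
    + apply lt_IZR. apply Rmult_lt_reg_r with u; auto. rewrite <- HgN, Rmult_0_l.
      now apply Rdiv_lt_0_compat.
    + now apply Hdiv.
    + now apply Hgcd.
    + rewrite Edelta in H6', H7'. split; apply lt_IZR; [rewrite opp_IZR|];
        apply Rmult_lt_reg_r with u; auto; lra.
    + eapply card_is_ext; [|exact H9]. now apply Hcard.
  - intros (g & r & dz & H1 & H2 & H3 & H4 & H5 & H6 & H7 & H8).
    assert (Hg : Bd = IZR g * (N * u)).
    { rewrite EBd, EN. rewrite <- (Rmult_assoc (IZR g)), <- mult_IZR. f_equal. f_equal. lia. }
    assert (HgN : Bd / N = IZR g * u) by (rewrite Hg; field; lra).
    assert (Hg0 : 0 < IZR g) by now apply IZR_lt.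
    fold zX in H3.
    split; [|split; [|split; [|split; [|split; [|split]]]]].
    + rewrite Hg. apply Rmult_lt_0_compat; auto. now apply Rmult_lt_0_compat.
    + rewrite Ebq. now exists g.
    + rewrite EX. unfold a. apply in_mult_scaled; [lra|]. now exists r.
    + now apply (Hdiv r).
    + exists (IZR dz * u). rewrite EnL, Ed1.
      assert (E0 : c0 = IZR (Z.of_nat (d1 + 1)) * (b - a) + IZR nL * Bd / N + IZR dz * u).
      { unfold Rdiv. rewrite Rmult_assoc. fold (Bd / N). rewrite HgN.
        unfold c0, a, b. rewrite H7, !plus_IZR, !mult_IZR, minus_IZR. ring. }
      split; [exact E0|].
      unfold Rdiv in E0. rewrite Rmult_assoc in E0. fold (Bd / N) in E0. rewrite HgN in *.
      destruct H6 as [H6 H6']. apply IZR_lt in H6, H6'. rewrite opp_IZR in H6.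
      apply Rmult_lt_compat_r with (r := u) in H6, H6'; auto.
      assert (Hba : 0 < b - a).
      { unfold a, b. rewrite <- Rmult_minus_distr_r. apply Rmult_lt_0_compat; auto.
        rewrite <- minus_IZR. apply IZR_lt. lia. }
      assert (Hgu : 0 < IZR g * u) by now apply Rmult_lt_0_compat.
      assert (Hgnn : forall n, (0 <= n)%Z -> 0 <= IZR n * (IZR g * u)).
      { intros n Hn. apply Rmult_le_pos; [|lra]. now apply IZR_le. }
      assert (Hbnn : forall n, (0 <= n)%Z -> 0 <= IZR n * (b - a)).
      { intros n Hn. apply Rmult_le_pos; [|lra]. now apply IZR_le. }
      (* With h = b - a and g, delta in real units, a - c0 + delta = (N - nL) g + (n1 - d1 - 1) h
         and c0 - h - delta = nL g + d1 h. Both are positive, which yields the bounds by a - c0 and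
         c0 + a - b in the two minima. *)
      assert (Ea : a = IZR ZN * (IZR g * u) + IZR n1 * (b - a)).
      { rewrite <- EN. replace (N * (IZR g * u)) with Bd by lra. unfold Bd. rewrite En1. ring. }
      pose proof (Hgnn (ZN - nL - 1)%Z ltac:(lia)) as B1.
      pose proof (Hbnn (n1 - Z.of_nat (d1 + 1))%Z ltac:(lia)) as B2.
      pose proof (Hgnn (nL - 1)%Z ltac:(lia)) as B3.
      pose proof (Hbnn (Z.of_nat (d1 + 1) - 1)%Z ltac:(lia)) as B4.
      rewrite 2!minus_IZR in B1. rewrite minus_IZR in B2, B3, B4.
      split.
      * apply Ropp_lt_cancel. rewrite Ropp_involutive. apply Rmin_glb_lt; lra.
      * apply Rmin_glb_lt; lra.
    + now apply (Hgcd r).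
    + eapply card_is_ext; [|exact H8]. intros n. symmetry. now apply Hcard.
Qed.

Theorem theorem7p1 (a b c : R) (p q : Z) :
  0 < a -> a < b -> b < c ->
  (0 < p)%Z -> (0 < q)%Z -> Z.gcd p q = 1%Z ->
  a / b = IZR p / IZR q ->
  (exists k : Z, c / b = IZR k / IZR q) ->
  let K := floorZ (c / b) in
  let c0 := c - IZR K * b in
  let c1 := IZR K * b - IZR (floorZ (IZR K * b / a)) * a in
  b - a < c0 -> c0 < a ->
  0 < c1 -> c1 < 2 * a - b ->
  (2 <= K)%Z ->
  ((exists t : R, in_S a b c t) <->
   ((exists g, is_lat_gcd b q a c1 g /\ c0 < g) \/
    (exists g, is_lat_gcd b q a (c1 + b) g /\ b - c0 < g) \/
    (exists d1 d2 d3 d4 : nat,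
       let N := INR (d1 + d2 + d3 + d4 + 2) in
       let Bd := a - INR (d1 + d2 + 1) * (b - a) in
       let X := N * c1 + INR (d1 + d3 + 1) * (b - a) in
       0 < Bd /\ in_mult Bd (N * (b / IZR q)) /\
       in_mult X a /\
       in_mult (INR (d1 + d2 + 1) * X - INR (d1 + d3 + 1) * a) (N * a) /\
       (exists delta : R,
          c0 = INR (d1 + 1) * (b - a) + INR (d1 + d3 + 1) * Bd / N + delta /\
          - Rmin (Bd / N) (a - c0) < delta /\
          delta < Rmin (Bd / N) (c0 + a - b)) /\
       is_lat_gcd b q X (N * a) a /\
       card_is (fun n : nat =>
                  (1 <= n <= d1 + d2 + 1)%nat /\
                  exists r : R, exists m : Z,
                    0 < r /\ r < INR (d1 + d3 + 1) * a /\
                    INR n * X = r + IZR m * (N * a)) d1))).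
Proof.
  intros Ha Hab Hbc Hp Hq _ Eab [k Ek] K c0 c1 Hc0 Hc0' Hc1 _ HK.
  assert (Hp' : 0 < IZR p) by now apply IZR_lt.
  assert (Hq' : 0 < IZR q) by now apply IZR_lt.
  pose (u := b / IZR q).
  assert (Hu : 0 < u) by (apply Rdiv_lt_0_compat; lra).
  assert (Eb : b = IZR q * u) by (unfold u; field; lra).
  assert (Ea : a = IZR p * u).
  { replace a with (a / b * b) by (field; lra). rewrite Eab. unfold u. field. lra. }
  assert (Ec : c = IZR k * u).
  { replace c with (c / b * b) by (field; lra). rewrite Ek. unfold u. field. lra. }
  assert (EK : K = (k / q)%Z).
  { unfold K. rewrite Ek. now apply floorZ_div. }
  set (z0 := (k - K * q)%Z). set (J := (K * q / p)%Z). set (z1 := (K * q - J * p)%Z).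
  assert (E0 : c0 = IZR z0 * u).
  { unfold c0, z0. rewrite minus_IZR, mult_IZR, Eb, Ec. ring. }
  assert (E1 : c1 = IZR z1 * u).
  { unfold c1, z1, J. rewrite <- floorZ_div by auto. rewrite minus_IZR, !mult_IZR.
    replace (IZR K * b / a) with (IZR K * IZR q / IZR p) by (rewrite Ea, Eb; field; lra).
    rewrite Ea, Eb. ring. }
  clearbody c0 c1 K u. clear Ek Eab. subst a b c c0 c1.
  assert (Hpq : (p < q)%Z) by (apply lt_IZR; apply Rmult_lt_reg_r with u; lra).
  assert (Hz0 : (q - p < z0)%Z).
  { apply lt_IZR. apply Rmult_lt_reg_r with u; auto. rewrite minus_IZR. lra. }
  assert (Hz0' : (z0 < p)%Z) by (apply lt_IZR; apply Rmult_lt_reg_r with u; lra).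
  assert (Hz1 : (0 < z1)%Z) by (apply lt_IZR; apply Rmult_lt_reg_r with u; lra).
  rewrite in_S_scaled by auto.
  replace k with (K * q + z0)%Z by (unfold z0; lia). clearbody z0.
  rewrite gcd_condition_scaled by auto.
  replace (IZR z1 * u + IZR q * u) with (IZR (z1 + q) * u) by (rewrite plus_IZR; ring).
  replace (IZR q * u - IZR z0 * u) with (IZR (q - z0) * u) by (rewrite minus_IZR; ring).
  rewrite gcd_condition_scaled by auto.
  (* Modulo a the translations by c1 + b and c1 + h agree, so case 2) concerns the displacement of
     the left points. *)
  replace (Z.gcd p (z1 + q)) with (Z.gcd p (z1 + (q - p)))
    by (rewrite <- (Z.gcd_add_diag_r p (z1 + (q - p))); f_equal; lia).
  assert (Hcyc : (exists t x, tiling p q (K * q + z0) t x) <->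
            has_cycle p (z0 - (q - p)) z0 (z1 + (q - p)) z1).
  { assert (D1 : (p | (K + 1) * q - (z1 + (q - p)))%Z) by (exists (J + 1)%Z; unfold z1; lia).
    assert (D2 : (p | K * q - z1)%Z) by (exists J; unfold z1; lia).
    split.
    - intros (t & x & Ht). apply cycle_of_tiling in Ht; auto; [|lia].
      revert Ht. now apply has_cycle_congr.
    - intros H. apply tiling_of_cycle; auto; [lia|].
      revert H. apply has_cycle_congr; rewrite <- Z.divide_opp_r.
      + now replace (- (z1 + (q - p) - (K + 1) * q))%Z with ((K + 1) * q - (z1 + (q - p)))%Z by lia.
      + now replace (- (z1 - K * q))%Z with (K * q - z1)%Z by lia. }
  rewrite Hcyc. clearbody z1. split.
  - intros H. apply cycle_cases in H; try lia.
    destruct H as [H|[H|(d1 & d2 & d3 & d4 & H)]]; [left; auto|right; left; lia|right; right].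
    exists d1, d2, d3, d4. now apply gap_pattern_scaled.
  - intros [H|[H|(d1 & d2 & d3 & d4 & H)]].
    + apply cycle_of_gcd_right; auto. lia.
    + apply cycle_of_gcd_left; auto. lia.
    + apply gap_pattern_scaled in H; auto. destruct H as (g & r & delta & H).
      apply cycle_of_gap_pattern in H; auto. lia.
Qed.
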